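(* Let $l>0$ and let $(\xi,\eta)$ be the elliptic coordinates on $\mathbb{R}^2$ given by $x_1=l\cosh\xi\cos\eta$, $x_2=l\sinh\xi\sin\eta$, $\xi\ge0$, $0\le\eta\le2\pi$. Let $0<\xi_i<\xi_e$ and let $D$ and $\Omega$ be the domains bounded by the confocal ellipses $\{\xi=\xi_i\}$ and $\{\xi=\xi_e\}$, respectively. Let $n\ge1$ be an integer. Let $(\varphi,p)$ be the solution of the electro-osmotic system (given in the context) with data $D,\Omega,H,P$ and zeta potential $\zeta_0\in\mathbb{R}$. (1) Let $H(x)=\cosh(n\xi)\cos(n\eta)$ and $P(x)=12\cosh(n\xi)\cos(n\eta)$. If $$\zeta_0=\frac{\sinh(n\xi_i)}{\big(\sinh(n\xi_e)-e^{n(\xi_i-\xi_e)}\sinh(n\xi_i)\big)\cosh(n(\xi_e-\xi_i))},$$ then the perfect hydrodynamic cloaking condition $\boldsymbol{u}_{aver}=-\nabla P/12$ in $\mathbb{R}^2\setminus\overline\Omega$ is satisfied. If $$\zeta_0=\frac{e^{n\xi_e}}{\sinh(n\xi_e)-e^{n(\xi_i-\xi_e)}\sinh(n\xi_i)},$$ then the perfect hydrodynamic shielding condition $\boldsymbol F=0$ is satisfied. (2) Let $H(x)=\sinh(n\xi)\sin(n\eta)$ and $P(x)=12\sinh(n\xi)\sin(n\eta)$. If $$\zeta_0=\frac{\cosh(n\xi_i)}{\big(\cosh(n\xi_e)-e^{n(\xi_i-\xi_e)}\cosh(n\xi_i)\big)\cosh(n(\xi_e-\xi_i))},$$ then the perfect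 hydrodynamic cloaking condition $\boldsymbol{u}_{aver}=-\nabla P/12$ in $\mathbb{R}^2\setminus\overline\Omega$ is satisfied. If $$\zeta_0=\frac{e^{n\xi_e}}{\cosh(n\xi_e)-e^{n(\xi_i-\xi_e)}\cosh(n\xi_i)},$$ then the perfect hydrodynamic shielding condition $\boldsymbol F=0$ is satisfied.
   Context: Electro-osmotic system: given a bounded domain $\Omega\subset\mathbb{R}^2$, a domain $D$ with $\overline D\subset\Omega$ (both of class $C^{1,\alpha}$ for some $0<\alpha<1$), harmonic functions $H,P$ on $\mathbb{R}^2$ (background electrostatic potential and pressure) and a constant $\zeta_0\in\mathbb{R}$, the electrostatic potential $\varphi$ and the pressure $p$ satisfy $$\Delta\varphi=0\ \text{in }\mathbb{R}^2\setminus\overline D,\qquad \frac{\partial\varphi}{\partial\nu}=0\ \text{on }\partial D,\qquad \varphi=H(x)+O(|x|^{-1})\ \text{as }|x|\to\infty,$$ $$\Delta p=0\ \text{in }(\mathbb{R}^2\setminus\overline D)\setminus\partial\Omega,\qquad \frac{\partial p}{\partial\nu}=0\ \text{on }\partial D,\qquad p|_+=p|_-\ \text{on }\partial\Omega,$$ $$\frac{\partial p}{\partial\nu}\Big|_+-\frac{\partial p}{\partial\nu}\Big|_-=12\zeta_0\frac{\partial\varphi}{\partial\nu}\ \text{on }\partial\Omega,\qquad p=P(x)+O(|x|^{-1})\ \text{as }|x|\to\infty.$$ Here $\nu$ is the outward unit normal, and for $x\in\partial\Omega$, $\frac{\partial p}{\partial\nu}\big|_\pm(x)=\lim_{t\to0^+}\langle\nabla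 p(x\pm t\nu(x)),\nu(x)\rangle$; $p|_\pm$ denotes the trace from outside ($+$) or inside ($-$) $\Omega$. The zeta potential distribution is $\zeta_{mean}=\zeta_0$ in $\Omega\setminus\overline D$ and $\zeta_{mean}=0$ in $\mathbb{R}^2\setminus\overline\Omega$. The depth-averaged velocity is $\boldsymbol{u}_{aver}=-\frac1{12}\nabla p-\zeta_{mean}\nabla\varphi$. The depth-averaged hydrodynamic force on the object is $\boldsymbol F=\int_{\partial D}\boldsymbol\sigma\cdot\nu\,ds$ with $\boldsymbol\sigma=-pI$ ($I$ the identity matrix). The triple $\{D,\Omega;\zeta_0\}$ is a perfect hydrodynamic cloaking if $\boldsymbol u_{aver}=-\nabla P/12$ in $\mathbb{R}^2\setminus\overline\Omega$, and a perfect hydrodynamic shielding if $\boldsymbol F=0$. *)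

(* Defs.v *)
From Stdlib Require Import Reals ClassicalEpsilon.
From Coquelicot Require Export Coquelicot.
Open Scope R_scope.

(** On this type the library's [norm] is the Euclidean norm. *)
Notation plane := (R * R)%type.

Definition dot (u v : plane) : R := fst u * fst v + snd u * snd v.

Definition closure (A : plane -> Prop) (x : plane) : Prop :=
  ~ locally x (fun y => ~ A y).

Definition boundary (A : plane -> Prop) (x : plane) : Prop :=
  closure A x /\ closure (fun y => ~ A y) x.

Definition exterior (A : plane -> Prop) (x : plane) : Prop := ~ closure A x.

Definition curried (f : plane -> R) : R -> R -> R := fun u v => f (u, v).

Definition grad (f : plane -> R) (x : plane) : plane :=
  (partial_derive 1 0 (curried f) (fst x) (snd x),
   partial_derive 0 1 (curried f) (fst x) (snd x)).

Definition laplacian (f : plane -> R) (x : plane) : R :=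
  partial_derive 2 0 (curried f) (fst x) (snd x) +
  partial_derive 0 2 (curried f) (fst x) (snd x).

(** [ex_diff_n f 2] at every point of an open set says that [f] is C^2 there. *)
Definition harmonic_on (U : plane -> Prop) (f : plane -> R) : Prop :=
  forall x, U x ->
    ex_diff_n (curried f) 2 (fst x) (snd x) /\ laplacian f x = 0.

(** [nu] is the outward unit normal to [A] at its boundary point [x]: near [x],
    [A] is a sublevel set of a C^1 function whose gradient at [x] is a positive
    multiple of [nu]. *)
Definition outward_unit_normal (A : plane -> Prop) (x nu : plane) : Prop :=
  boundary A x /\ norm nu = 1 /\
  exists (rho : plane -> R) (k : R),
    locally x (fun y => ex_diff_n (curried rho) 1 (fst y) (snd y)) /\
    locally x (fun y => A y <-> rho y < 0) /\
    0 < k /\ grad rho x = scal k nu.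

Definition is_trace (U : plane -> Prop) (f : plane -> R) (x : plane) (v : R) : Prop :=
  filterlim f (within U (locally x)) (locally v).

Definition is_normal_derivative_plus (f : plane -> R) (x nu : plane) (v : R) : Prop :=
  filterlim (fun t => dot (grad f (plus x (scal t nu))) nu) (at_right 0) (locally v).

Definition is_normal_derivative_minus (f : plane -> R) (x nu : plane) (v : R) : Prop :=
  filterlim (fun t => dot (grad f (minus x (scal t nu))) nu) (at_right 0) (locally v).

Definition asymptotic (f g : plane -> R) : Prop :=
  exists C r : R, 0 < r /\
    forall x : plane, r <= norm x -> Rabs (f x - g x) <= C / norm x.

(** Solutions are classical: C^2 off the interfaces, with traces on them.
    The values of [phi] and [p] on the closure of [D], and those of [p] on the boundary of
    [Omega], are irrelevant: only traces from the open regions are used. *)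
Record electro_osmotic (D Omega : plane -> Prop) (zeta0 : R)
    (H P phi p : plane -> R) : Prop := {
  phi_harmonic : harmonic_on (exterior D) phi;
  phi_trace_D : forall x, boundary D x -> exists v, is_trace (exterior D) phi x v;
  phi_neumann_D : forall x nu, outward_unit_normal D x nu ->
    is_normal_derivative_plus phi x nu 0;
  phi_infinity : asymptotic phi H;
  p_harmonic : harmonic_on (fun x => exterior D x /\ ~ boundary Omega x) p;
  p_trace_D : forall x, boundary D x -> exists v, is_trace (exterior D) p x v;
  p_neumann_D : forall x nu, outward_unit_normal D x nu ->
    is_normal_derivative_plus p x nu 0;
  p_trace_Omega : forall x, boundary Omega x -> exists v,
    is_trace (exterior Omega) p x v /\
    is_trace (fun y => Omega y /\ exterior D y) p x v;
  p_jump_Omega : forall x nu, outward_unit_normal Omega x nu ->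
    exists vp vm : R,
      is_normal_derivative_plus p x nu vp /\
      is_normal_derivative_minus p x nu vm /\
      vp - vm = 12 * zeta0 * dot (grad phi x) nu;
  p_infinity : asymptotic p P
}.

Definition zeta_mean (D Omega : plane -> Prop) (zeta0 : R) (x : plane) : R :=
  if excluded_middle_informative (Omega x /\ exterior D x) then zeta0 else 0.

Definition u_aver (D Omega : plane -> Prop) (zeta0 : R) (phi p : plane -> R)
    (x : plane) : plane :=
  minus (scal (- / 12) (grad p x)) (scal (zeta_mean D Omega zeta0 x) (grad phi x)).

Definition perfect_cloaking (D Omega : plane -> Prop) (zeta0 : R)
    (P phi p : plane -> R) : Prop :=
  forall x, exterior Omega x ->
    u_aver D Omega zeta0 phi p x = scal (- / 12) (grad P x).

(** [g] is a regular C^1 parametrization on [[a, b]], with velocity [dg], of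
    the boundary of [A] as a simple closed curve. *)
Definition boundary_parametrization (A : plane -> Prop) (a b : R)
    (g dg : R -> plane) : Prop :=
  a < b /\ g a = g b /\
  (forall s t, a <= s < b -> a <= t < b -> g s = g t -> s = t) /\
  (forall x, boundary A x <-> exists t, a <= t <= b /\ g t = x) /\
  (forall t, a <= t <= b ->
     is_derive g t (dg t) /\ continuous dg t /\ dg t <> zero).

(** The action of the tensor [- q I] on vectors. *)
Definition stress (q : R) (v : plane) : plane := scal (- q) v.

(** [F] is the integral over the boundary of [D], with respect to arc length,
    of [stress p . nu]; here [q] is the exterior trace of [p] along the curve. *)
Definition is_hydrodynamic_force (D : plane -> Prop) (p : plane -> R) (F : plane) : Prop :=
  exists (a b : R) (g dg nu : R -> plane) (q : R -> R),
    boundary_parametrization D a b g dg /\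
    (forall t, a <= t <= b -> outward_unit_normal D (g t) (nu t)) /\
    (forall t, a <= t <= b -> is_trace (exterior D) p (g t) (q t)) /\
    is_RInt (fun t => scal (norm (dg t)) (stress (q t) (nu t))) a b F.

Definition perfect_shielding (D : plane -> Prop) (p : plane -> R) : Prop :=
  is_hydrodynamic_force D p zero.

Definition elliptic (l xi eta : R) : plane :=
  (l * cosh xi * cos eta, l * sinh xi * sin eta).

(** The inside of the ellipse [xi = xi0]; [xi = 0] is its focal segment. *)
Definition elliptic_domain (l xi0 : R) (x : plane) : Prop :=
  exists xi eta, 0 <= xi < xi0 /\ 0 <= eta <= 2 * PI /\ x = elliptic l xi eta.

(** Elliptic coordinates cover the plane, so this determines [f] completely. *)
Definition elliptic_expression (l : R) (f : plane -> R) (h : R -> R -> R) : Prop :=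
  forall xi eta, 0 <= xi -> 0 <= eta <= 2 * PI -> f (elliptic l xi eta) = h xi eta.

(* Main.v *)
(** The solution is unique by a weak maximum principle for transmission problems: adding a small
    multiple of a strictly subharmonic barrier, whose normal derivative is positive on the inner
    ellipse and jumps upwards across the outer one, to the difference of two solutions leaves no
    point where a maximum could be attained.

    The solution itself is separable in elliptic coordinates. With [q = exp (- (xi + i eta))], the
    solution of [x = (l / 2) (q + 1 / q)] in the unit disc, the functions
    [exp (n xi) cos (n eta)], [exp (- n xi) cos (n eta)] and their sine analogues are the real and
    imaginary parts of the holomorphic functions [q ^ (- n)] and [q ^ n], and differentiation along
    the normal of a confocal ellipse is, up to a factor, differentiation in [xi]. Solving for the
    coefficients, the first value of [zeta0] makes the decaying part of [p] outside [Omega] equal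
    to that of [P], and the second one makes [p] vanish between the two ellipses. *)

Require Import Defs.
From Stdlib Require Import Reals Lra Lia List Classical ClassicalChoice ClassicalEpsilon.
From Coquelicot Require Import Coquelicot.
Open Scope R_scope.

(** * One-variable growth and compactness *)

(** It is replaced by a covering argument: around every point of a large box, some fixed value of
    the function beats all nearby ones. A positive limit of the derivative along a ray becomes
    growth above the trace by the mean value theorem, and as the barrier makes all inequalities
    strict, no Hopf lemma enters.

    The coordinates [xi], [eta] are singular on the focal segment and [eta] is multivalued, so
    nothing is differentiated through them. The inverse map [jinv] is handled algebraically, and its
    injectivity, continuity and derivative all come from one identity for differences of Joukowski
    values.

    Both parts of the theorem are one computation: a sign [sigma] distinguishes cosh from sinh in
    the data and a complex number [kappa] distinguishes cos from sin. *)

Lemma increasing_from_limit (k dk : R -> R) (v d : R) :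
  (forall t, 0 < t < d -> is_derive k t (dk t) /\ 0 < dk t) ->
  filterlim k (at_right 0) (locally v) ->
  forall t, 0 < t < d -> v < k t.
Proof.
intros Hk Hv t Ht.
assert (Hinc : forall s u, 0 < s < u -> u < d -> k s < k u).
{ intros s u Hs Hu.
  destruct (MVT_gen k s u dk) as [c [Hc Hcu]].
  - intros x; rewrite Rmin_left, Rmax_right by lra; intros Hx; apply Hk; lra.
  - intros x; rewrite Rmin_left, Rmax_right by lra; intros Hx.
    apply derivable_continuous_pt.
    exists (dk x); apply is_derive_Reals, Hk; lra.
  - rewrite Rmin_left, Rmax_right in Hc by lra.
    assert (H0 : 0 < dk c) by (apply Hk; lra).
    assert (0 < dk c * (u - s)) by (apply Rmult_lt_0_compat; lra); lra. }
apply Rle_lt_trans with (k (t / 2)); [|apply Hinc; lra].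
destruct (Rle_or_lt v (k (t / 2))) as [h|h]; [exact h|exfalso].
assert (he : 0 < v - k (t / 2)) by lra.
assert (Hnear := proj1 (filterlim_locally _ _) Hv (mkposreal _ he)).
assert (Hsmall : at_right 0 (fun s => s < t / 2)).
{ assert (ht : 0 < t / 2) by lra.
  exists (mkposreal _ ht); intros s Hs _.
  apply Rabs_def2 in Hs; unfold minus, plus, opp in Hs; simpl in Hs; lra. }
assert (Hpos : at_right 0 (fun s => 0 < s)).
{ exists (mkposreal 1 Rlt_0_1); intros s _ Hs; exact Hs. }
destruct (filter_ex _ (filter_and _ _ Hnear (filter_and _ _ Hsmall Hpos)))
  as [s [H1 [H2 H3]]].
apply Rabs_def2 in H1; unfold minus, plus, opp in H1; simpl in H1.
assert (k s < k (t / 2)) by (apply Hinc; lra); lra.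
Qed.

Lemma at_right_eventually (P : R -> Prop) :
  at_right 0 P -> exists d, 0 < d /\ forall t, 0 < t < d -> P t.
Proof.
intros [d Hd]; exists d; split; [apply cond_pos|].
intros t Ht; apply Hd; [|apply Ht].
apply Rabs_def1; unfold minus, plus, opp; simpl; lra.
Qed.

Lemma eventually_at_right (P : R -> Prop) (d : R) :
  0 < d -> (forall t, 0 < t < d -> P t) -> at_right 0 P.
Proof.
intros hd H; exists (mkposreal d hd); intros t Ht Ht'.
apply H; split; [exact Ht'|].
apply Rabs_def2 in Ht; unfold minus, plus, opp in Ht; simpl in Ht; lra.
Qed.

Lemma growth_along_ray (k dk : R -> R) (v L : R) :
  at_right 0 (fun t => is_derive k t (dk t)) ->
  filterlim dk (at_right 0) (locally L) -> 0 < L ->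
  filterlim k (at_right 0) (locally v) ->
  at_right 0 (fun t => v < k t).
Proof.
intros Hk HL hL Hv.
assert (HL' := proj1 (filterlim_locally _ _) HL (mkposreal L hL)).
destruct (at_right_eventually _ (filter_and _ _ Hk HL')) as [d [hd Hd]].
apply (eventually_at_right _ d hd).
apply (increasing_from_limit k dk v d); [|exact Hv].
intros t Ht; destruct (Hd t Ht) as [H1 H2]; split; [exact H1|].
apply Rabs_def2 in H2; unfold minus, plus, opp in H2; simpl in H2; lra.
Qed.

(** Move from [t0] in the direction [s] in which [h] does not initially decrease. Since [dh] has
    positive slope [a] at [t0], the derivative in that direction becomes positive at once, and [h]
    increases. *)
Lemma not_local_max (h dh : R -> R) (t0 a : R) :
  locally t0 (fun t => is_derive h t (dh t)) -> is_derive dh t0 a -> 0 < a ->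
  forall d, 0 < d -> exists t, Rabs (t - t0) < d /\ h t0 < h t.
Proof.
intros Hh Ha ha d hd.
assert (Hs : exists s, (s = 1 \/ s = -1) /\ 0 <= s * dh t0).
{ destruct (Rle_or_lt 0 (dh t0)); [exists 1|exists (-1)]; split; auto; lra. }
destruct Hs as [s [hs hs0]].
assert (s2 : s * s = 1) by (destruct hs; subst; ring).
destruct Hh as [d1 Hd1].
assert (Hq : is_lim (fun t => (dh (t0 + t) - dh t0) / t) 0 a).
{ apply is_derive_Reals in Ha; apply is_lim_spec; intros e.
  destruct (Ha e (cond_pos e)) as [d2 Hd2].
  exists d2; intros t Ht Ht0; apply Hd2; [exact Ht0|].
  unfold ball in Ht; simpl in Ht; unfold AbsRing_ball, abs, minus, plus, opp in Ht; simpl in Ht.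
  replace t with (t + - 0) by ring; exact Ht. }
apply is_lim_spec in Hq; destruct (Hq (mkposreal a ha)) as [d2 Hd2].
set (e := Rmin d (Rmin d1 d2)).
assert (he : 0 < e).
{ unfold e; repeat apply Rmin_glb_lt; [lra|apply cond_pos|apply cond_pos]. }
assert (e <= d /\ e <= d1 /\ e <= d2) as (E1 & E2 & E3).
{ unfold e; repeat split.
  - apply Rmin_l.
  - eapply Rle_trans; [apply Rmin_r|apply Rmin_l].
  - eapply Rle_trans; [apply Rmin_r|apply Rmin_r]. }
assert (Hsabs : forall t, 0 < t < e -> Rabs (s * t) < e).
{ intros t Ht; rewrite Rabs_mult; replace (Rabs s) with 1.
  - rewrite Rabs_right; lra.
  - destruct hs; subst s; [rewrite Rabs_R1|rewrite Rabs_left]; lra. }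
assert (Hd : forall t, 0 < t < e -> h t0 < h (t0 + s * t)).
{ apply (increasing_from_limit _ (fun t => s * dh (t0 + s * t))).
  - intros t Ht; assert (Hst := Hsabs t Ht); split.
    + apply (is_derive_comp h (fun t => t0 + s * t)).
      * apply Hd1; unfold ball; simpl; unfold AbsRing_ball, abs, minus, plus, opp; simpl.
        replace (t0 + s * t + - t0) with (s * t) by ring; lra.
      * auto_derive; auto; ring.
    + assert (Hst0 : s * t <> 0).
      { intros H; assert (H' : s * (s * t) = 0) by (rewrite H; ring).
        rewrite <- Rmult_assoc, s2 in H'; lra. }
      assert (H := Hd2 (s * t)); simpl in H.
      assert (H' : Rabs ((dh (t0 + s * t) - dh t0) / (s * t) - a) < a).
      { apply H; [|exact Hst0].
        unfold ball; simpl; unfold AbsRing_ball, abs, minus, plus, opp; simpl.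
        replace (s * t + - 0) with (s * t) by ring; lra. }
      apply Rabs_def2 in H'.
      set (q := (dh (t0 + s * t) - dh t0) / (s * t)) in *.
      assert (Eq : dh (t0 + s * t) = dh t0 + q * (s * t))
        by (unfold q; field; split; intros E0; apply Hst0; rewrite E0; ring).
      rewrite Eq.
      replace (s * (dh t0 + q * (s * t))) with (s * dh t0 + s * s * q * t) by ring.
      rewrite s2; assert (0 < q * t) by (apply Rmult_lt_0_compat; lra); lra.
  - assert (Hc : continuous (fun t => h (t0 + s * t)) 0).
    { apply (continuous_comp (fun t => t0 + s * t) h).
      - apply (ex_derive_continuous (K:=R_AbsRing) (V:=R_NormedModule)); auto_derive; auto.
      - replace (t0 + s * 0) with t0 by ring.
        apply (ex_derive_continuous (K:=R_AbsRing) (V:=R_NormedModule)); exists (dh t0).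
        apply (locally_singleton t0 (fun t => is_derive h t (dh t))).
        exists d1; exact Hd1. }
    unfold continuous in Hc; replace (t0 + s * 0) with t0 in Hc by ring.
    eapply filterlim_filter_le_1; [|exact Hc].
    apply filter_le_within. }
exists (t0 + s * (e / 2)); split.
- replace (t0 + s * (e / 2) - t0) with (s * (e / 2)) by ring.
  apply Rlt_le_trans with e; [apply Hsabs; lra|exact E1].
- apply Hd; lra.
Qed.

Definition box (R0 : R) (x : plane) : Prop := Rabs (fst x) <= R0 /\ Rabs (snd x) <= R0.

(** If near every point of the box some other value of [f] on [S] beats all nearby ones,
    a finite subcover would leave the best of finitely many values beaten. *)
Lemma no_escape_from_box (R0 : R) (S : plane -> Prop) (f : plane -> R) :
  (forall x, S x -> box R0 x) ->
  (forall x, box R0 x -> exists d y, 0 < d /\ S y /\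
     forall z, S z -> Rabs (fst z - fst x) < d -> Rabs (snd z - snd x) < d -> f z < f y) ->
  forall x, ~ S x.
Proof.
intros HS Hesc x0 Hx0.
assert (Hch : forall x : plane, exists dy : posreal * plane, box R0 x -> S (snd dy) /\
   forall z, S z -> Rabs (fst z - fst x) < fst dy -> Rabs (snd z - snd x) < fst dy ->
     f z < f (snd dy)).
{ intros x; destruct (classic (box R0 x)) as [Hx|Hx].
  - destruct (Hesc x Hx) as [d [y [hd [Hy H]]]]; exists (mkposreal d hd, y); intros _; split; auto.
  - exists (mkposreal 1 Rlt_0_1, x); intros H; contradiction. }
destruct (choice _ Hch) as [F HF]; clear Hch.
(* The finite subcover comes under a double negation, which is enough because the goal is
   [False]. *)
apply (compactness_list 2 (- R0, (- R0, tt)) (R0, (R0, tt))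
  (fun t => fst (F (fst t, fst (snd t))))).
intros [l Hl].
assert (Hcov : forall z, S z -> exists t, In t l /\
  box R0 (fst t, fst (snd t)) /\ f z < f (snd (F (fst t, fst (snd t))))).
{ intros z Hz; destruct (HS z Hz) as [Hz1 Hz2].
  assert (Hbz : bounded_n 2 (- R0, (- R0, tt)) (R0, (R0, tt)) (fst z, (snd z, tt))).
  { split; [|split; [|exact I]]; apply Rabs_le_between; auto. }
  destruct (Hl _ Hbz) as [[t1 [t2 []]] [Hin [Hb Hc]]].
  exists (t1, (t2, tt)); simpl in *.
  destruct Hb as [Hb1 [Hb2 _]]; destruct Hc as [Hc1 [Hc2 _]].
  assert (Hbox : box R0 (t1, t2)) by (split; apply Rabs_le_between; auto).
  split; [exact Hin|split; [exact Hbox|]].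
  apply (HF _ Hbox); auto. }
assert (Hfin : forall m : list (Compactness.Tn 2 R),
   (exists t, In t m /\ box R0 (fst t, fst (snd t))) ->
   exists t, In t m /\ box R0 (fst t, fst (snd t)) /\
     forall u, In u m -> box R0 (fst u, fst (snd u)) ->
       f (snd (F (fst u, fst (snd u)))) <= f (snd (F (fst t, fst (snd t))))).
{ induction m as [|t m IH]; [intros [t [[] _]]|intros Hex].
  destruct (classic (exists t, In t m /\ box R0 (fst t, fst (snd t)))) as [Hm|Hm].
  - destruct (IH Hm) as [u [Hu1 [Hu2 Hu3]]].
    destruct (classic (box R0 (fst t, fst (snd t)))) as [Ht|Ht].
    + destruct (Rle_or_lt (f (snd (F (fst t, fst (snd t))))) (f (snd (F (fst u, fst (snd u))))))
        as [Hle|Hlt].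
      * exists u; repeat split; [right; exact Hu1|apply Hu2|apply Hu2|].
        intros v [<-|Hv] Hbv; auto.
      * exists t; repeat split; [left; reflexivity|apply Ht|apply Ht|].
        intros v [<-|Hv] Hbv; [apply Rle_refl|].
        apply Rle_trans with (1 := Hu3 v Hv Hbv); lra.
    + exists u; repeat split; [right; exact Hu1|apply Hu2|apply Hu2|].
      intros v [<-|Hv] Hbv; [contradiction|auto].
  - destruct Hex as [u [[<-|Hu] Hbu]].
    + exists t; repeat split; [left; reflexivity|apply Hbu|apply Hbu|].
      intros v [<-|Hv] Hbv; [apply Rle_refl|].
      exfalso; apply Hm; exists v; auto.
    + exfalso; apply Hm; exists u; auto. }
destruct (Hfin l) as [t [Ht1 [Ht2 Ht3]]].
{ destruct (Hcov x0 Hx0) as [t [H1 [H2 _]]]; exists t; auto. }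
destruct (HF _ Ht2) as [Hy _].
destruct (Hcov _ Hy) as [u [Hu1 [Hu2 Hu3]]].
specialize (Ht3 u Hu1 Hu2); lra.
Qed.

(** * Functions with a continuous gradient and a Laplacian *)

Lemma near_plane (x : plane) (P : plane -> Prop) :
  locally x P <-> exists d, 0 < d /\
    forall y : plane, Rabs (fst y - fst x) < d -> Rabs (snd y - snd x) < d -> P y.
Proof.
split.
- intros [d Hd]; exists d; split; [apply cond_pos|].
  intros y H1 H2; apply Hd; split; assumption.
- intros [d [hd Hd]]; exists (mkposreal d hd); intros y [H1 H2]; apply Hd; assumption.
Qed.

Lemma locally_horizontal (x : plane) (P : plane -> Prop) :
  locally x P -> locally (fst x) (fun t => P (t, snd x)).
Proof.
intros [d Hd]; exists d; intros t Ht; apply Hd; split; [exact Ht|apply ball_center].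
Qed.

Lemma locally_vertical (x : plane) (P : plane -> Prop) :
  locally x P -> locally (snd x) (fun t => P (fst x, t)).
Proof.
intros [d Hd]; exists d; intros t Ht; apply Hd; split; [apply ball_center|exact Ht].
Qed.

(** [g] plays the role of the gradient of [w] near [x], and [s] is the Laplacian at [x]. *)
Definition laplacian_at (w : plane -> R) (g : plane -> plane) (s : R) (x : plane) : Prop :=
  locally x (fun y =>
    is_derive (fun t => w (t, snd y)) (fst y) (fst (g y)) /\
    is_derive (fun t => w (fst y, t)) (snd y) (snd (g y))) /\
  continuous w x /\
  locally x (fun y => continuous (fun z => fst (g z)) y /\ continuous (fun z => snd (g z)) y) /\
  exists a b, is_derive (fun t => fst (g (t, snd x))) (fst x) a /\
    is_derive (fun t => snd (g (fst x, t))) (snd x) b /\ a + b = s.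

Lemma laplacian_at_ext (w w' : plane -> R) (g g' : plane -> plane) (s : R) (x : plane) :
  locally x (fun y => w y = w' y /\ g y = g' y) ->
  laplacian_at w g s x -> laplacian_at w' g' s x.
Proof.
intros He [Hd [Hc [Hg [a [b [Ha [Hb Hs]]]]]]].
assert (He' := locally_locally _ _ He).
split; [|split; [|split]].
- generalize (filter_and _ _ He' Hd); apply filter_imp; intros y [Hy [H1 H2]].
  assert (Hyy := locally_singleton _ _ Hy); destruct Hyy as [_ <-].
  split.
  + apply is_derive_ext_loc with (2 := H1).
    generalize (locally_horizontal _ _ Hy); apply filter_imp; intros t [Ht _]; exact Ht.
  + apply is_derive_ext_loc with (2 := H2).
    generalize (locally_vertical _ _ Hy); apply filter_imp; intros t [Ht _]; exact Ht.
- apply continuous_ext_loc with (2 := Hc).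
  generalize He; apply filter_imp; intros y [-> _]; reflexivity.
- generalize (filter_and _ _ He' Hg); apply filter_imp; intros y [Hy [H1 H2]].
  split; [apply continuous_ext_loc with (2 := H1)|apply continuous_ext_loc with (2 := H2)];
  generalize Hy; apply filter_imp; intros z [_ ->]; reflexivity.
- exists a, b; split; [|split; [|exact Hs]].
  + apply is_derive_ext_loc with (2 := Ha).
    generalize (locally_horizontal _ _ He); apply filter_imp; intros t [_ Ht].
    exact (f_equal fst Ht).
  + apply is_derive_ext_loc with (2 := Hb).
    generalize (locally_vertical _ _ He); apply filter_imp; intros t [_ Ht].
    exact (f_equal snd Ht).
Qed.

Lemma laplacian_at_combine (c : R) (w w' : plane -> R) (g g' : plane -> plane)
    (s s' : R) (x : plane) :
  laplacian_at w g s x -> laplacian_at w' g' s' x ->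
  laplacian_at (fun y => w y + c * w' y) (fun y => plus (g y) (scal c (g' y)))
    (s + c * s') x.
Proof.
assert (Hlin : forall (u v : R -> R) (t a b : R), is_derive u t a -> is_derive v t b ->
  is_derive (fun t => u t + c * v t) t (a + c * b)).
{ intros u v t a b Hu Hv; apply (is_derive_plus u (fun t => c * v t) t a (c * b) Hu).
  apply is_derive_scal; exact Hv. }
assert (Hcont : forall (u v : plane -> R) y, continuous u y -> continuous v y ->
  continuous (fun y => u y + c * v y) y).
{ intros u v y Hu Hv; apply (continuous_plus u (fun y => c * v y) y Hu).
  apply (continuous_scal_r c v); exact Hv. }
intros [Hd [Hc [Hg [a [b [Ha [Hb Hs]]]]]]] [Hd' [Hc' [Hg' [a' [b' [Ha' [Hb' Hs']]]]]]].
split; [|split; [|split]].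
- generalize (filter_and _ _ Hd Hd'); apply filter_imp; intros y [[H1 H2] [H1' H2']].
  split; [exact (Hlin _ _ _ _ _ H1 H1')|exact (Hlin _ _ _ _ _ H2 H2')].
- apply Hcont; assumption.
- generalize (filter_and _ _ Hg Hg'); apply filter_imp; intros y [[H1 H2] [H1' H2']].
  split; [exact (Hcont _ _ _ H1 H1')|exact (Hcont _ _ _ H2 H2')].
- exists (a + c * a'), (b + c * b'); split; [|split].
  + exact (Hlin _ _ _ _ _ Ha Ha').
  + exact (Hlin _ _ _ _ _ Hb Hb').
  + subst; ring.
Qed.

Lemma harmonic_laplacian_at (U : plane -> Prop) (w : plane -> R) (x : plane) :
  locally x U -> harmonic_on U w -> laplacian_at w (grad w) 0 x.
Proof.
intros HU Hw.
assert (HC : forall y, U y ->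
    is_derive (fun t => w (t, snd y)) (fst y) (fst (grad w y)) /\
    is_derive (fun t => w (fst y, t)) (snd y) (snd (grad w y)) /\
    continuous w y /\ continuous (fun z => fst (grad w z)) y /\
    continuous (fun z => snd (grad w z)) y).
{ intros y Hy; destruct (Hw y Hy) as [[Hc [Hx [Hy' [[Hcx _] [Hcy _]]]]] _].
  split; [|split; [|split; [|split]]].
  - apply Derive_correct in Hx; exact Hx.
  - apply Derive_correct in Hy'; exact Hy'.
  - apply continuity_2d_pt_filterlim in Hc; destruct y as [y1 y2]; simpl in Hc.
    unfold continuous; eapply filterlim_ext; [|exact Hc]; intros [z1 z2]; reflexivity.
  - apply continuity_2d_pt_filterlim in Hcx; destruct y as [y1 y2]; exact Hcx.
  - apply continuity_2d_pt_filterlim in Hcy; destruct y as [y1 y2]; exact Hcy. }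
assert (Hx := locally_singleton _ _ HU); split; [|split; [|split]].
- generalize HU; apply filter_imp; intros y Hy; split; apply (HC y Hy).
- apply (HC x Hx).
- generalize HU; apply filter_imp; intros y Hy; apply (HC y Hy).
- destruct (Hw x Hx) as [[_ [_ [_ [[_ [Hxx _]] [_ [_ [Hyy _]]]]]]] Hl].
  exists (partial_derive 2 0 (curried w) (fst x) (snd x)),
    (partial_derive 0 2 (curried w) (fst x) (snd x)); split; [|split].
  + apply Derive_correct in Hxx; exact Hxx.
  + apply Derive_correct in Hyy; exact Hyy.
  + exact Hl.
Qed.

(** Continuity of one partial derivative and existence of the other give total differentiability,
    which the chain rule along slanted normal lines requires. *)
Lemma laplacian_at_differentiable (w : plane -> R) (g : plane -> plane) (s : R) (x : plane) :
  laplacian_at w g s x ->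
  differentiable_pt_lim (fun a b => w (a, b)) (fst x) (snd x) (fst (g x)) (snd (g x)).
Proof.
destruct x as [x1 x2]; intros [Hd [_ [Hg _]]]; simpl.
apply filterdiff_differentiable_pt_lim.
apply (is_derive_filterdiff (fun a b => w (a, b)) x1 x2
    (fun a b => fst (g (a, b))) (snd (g (x1, x2)))).
- generalize Hd; apply filter_imp; intros [u1 u2] [H _]; exact H.
- destruct (locally_singleton _ _ Hd) as [_ H]; exact H.
- apply locally_singleton in Hg; destruct Hg as [Hg _].
  unfold continuous in *; simpl in *; eapply filterlim_ext; [|exact Hg].
  intros [z1 z2]; reflexivity.
Qed.

Lemma laplacian_at_along_line (w : plane -> R) (g : plane -> plane) (s : R) (x nu : plane)
    (t : R) :
  laplacian_at w g s (plus x (scal t nu)) ->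
  is_derive (fun t => w (plus x (scal t nu))) t (dot (g (plus x (scal t nu))) nu).
Proof.
intros Hl; apply laplacian_at_differentiable in Hl.
apply is_derive_Reals.
assert (Hlin : forall a b, derivable_pt_lim (fun t => a + t * b) t b).
{ intros a b; apply is_derive_Reals; auto_derive; auto; ring. }
exact (derivable_pt_lim_comp_2d (fun a b => w (a, b))
   (fun t => fst x + t * fst nu) (fun t => snd x + t * snd nu) t _ _ _ _ Hl
   (Hlin _ _) (Hlin _ _)).
Qed.

(** The negation of a local maximum, with the trace [v] in place of [f x], so that it also makes
    sense on an interface. *)
Definition growth_point (U : plane -> Prop) (f : plane -> R) (x : plane) (v : R) : Prop :=
  is_trace U f x v /\ forall V, locally x V -> exists y, U y /\ V y /\ v < f y.

(** A positive Laplacian makes one of the two pure second derivatives positive, and the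
    corresponding coordinate line through [x] already leads to larger values. *)
Lemma growth_at_interior (U : plane -> Prop) (f : plane -> R) (g : plane -> plane)
    (s : R) (x : plane) :
  locally x U -> laplacian_at f g s x -> 0 < s -> growth_point U f x (f x).
Proof.
intros HU [Hd [Hc [_ [a [b [Ha [Hb Hs]]]]]]] hs; split.
- eapply filterlim_filter_le_1; [|exact Hc]; apply filter_le_within.
- intros V HV.
  assert (HUV := filter_and _ _ HU HV).
  destruct (Rlt_or_le 0 a) as [ha|ha].
  + destruct (locally_horizontal _ _ HUV) as [d Hd'].
    destruct (not_local_max (fun t => f (t, snd x)) (fun t => fst (g (t, snd x))) (fst x) a)
      with (d := pos d) as [t [Ht1 Ht2]]; auto.
    * generalize (locally_horizontal _ _ Hd); apply filter_imp; intros t [H _]; exact H.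
    * apply cond_pos.
    * destruct (Hd' t Ht1) as [H1 H2]; exists (t, snd x); repeat split; auto.
      destruct x; exact Ht2.
  + destruct (locally_vertical _ _ HUV) as [d Hd'].
    destruct (not_local_max (fun t => f (fst x, t)) (fun t => snd (g (fst x, t))) (snd x) b)
      with (d := pos d) as [t [Ht1 Ht2]]; auto.
    * generalize (locally_vertical _ _ Hd); apply filter_imp; intros t [_ H]; exact H.
    * lra.
    * apply cond_pos.
    * destruct (Hd' t Ht1) as [H1 H2]; exists (fst x, t); repeat split; auto.
      destruct x; exact Ht2.
Qed.

Lemma ray_to_point (x nu : plane) :
  filterlim (fun t : R => plus x (scal t nu)) (at_right 0) (locally x).
Proof.
assert (H : continuous (fun t : R => plus x (scal t nu)) 0).
{ apply (continuous_plus (fun _ : R => x) (fun t : R => scal t nu)).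
  - apply continuous_const.
  - apply (continuous_scal_l (fun t : R => t) nu); apply continuous_id. }
unfold continuous in H; replace (plus x (scal 0 nu)) with x in H.
- eapply filterlim_filter_le_1; [|exact H]; apply filter_le_within.
- rewrite @scal_zero_l; symmetry; apply plus_zero_r.
Qed.

Lemma ray_eventually (x nu : plane) (P : plane -> Prop) :
  locally x P -> at_right 0 (fun t => P (plus x (scal t nu))).
Proof. intros H; apply (ray_to_point x nu); exact H. Qed.

(** The boundary counterpart of [growth_at_interior]: a positive limit of the directional derivative
    forces values above the trace. The direction [nu] may point to either side of an interface. *)
Lemma growth_along_inner_ray (U V : plane -> Prop) (f : plane -> R) (g : plane -> plane)
    (s : plane -> R) (x nu : plane) (v L : R) :
  (forall y, V y -> U y /\ laplacian_at f g (s y) y) ->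
  is_trace U f x v ->
  at_right 0 (fun t => V (plus x (scal t nu))) ->
  filterlim (fun t => dot (g (plus x (scal t nu))) nu) (at_right 0) (locally L) -> 0 < L ->
  growth_point U f x v.
Proof.
intros HV Ht HVt HL hL; split; [exact Ht|].
assert (Hg : at_right 0 (fun t => v < f (plus x (scal t nu)))).
{ apply (growth_along_ray _ (fun t => dot (g (plus x (scal t nu))) nu) v L); auto.
  - generalize HVt; apply filter_imp; intros t H.
    apply laplacian_at_along_line with (s := s (plus x (scal t nu))); apply HV; exact H.
  - eapply filterlim_comp; [|exact Ht].
    intros P HP; unfold filtermap; unfold within in HP.
    generalize (filter_and _ _ HVt (ray_eventually x nu _ HP)); apply filter_imp.
    intros t [H1 H2]; apply H2, HV, H1. }
intros W HW.
destruct (filter_ex _ (filter_and _ _ Hg (filter_and _ _ HVt (ray_eventually x nu _ HW))))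
  as [t [H1 [H2 H3]]].
exists (plus x (scal t nu)); repeat split; auto; apply HV, H2.
Qed.

(** Supplies the local condition of [no_escape_from_box]. A point [y] with [f y > v] is fixed first;
    then the trace keeps [f] within [f y - v] of [v] near [x], hence below [f y]. *)
Lemma escape_at_growth_point (U : plane -> Prop) (f : plane -> R) (x : plane) (v R0 : R) :
  growth_point U f x v -> Rabs (fst x) < R0 -> Rabs (snd x) < R0 ->
  exists d y, 0 < d /\ (U y /\ box R0 y) /\
    forall z, U z /\ box R0 z -> Rabs (fst z - fst x) < d -> Rabs (snd z - snd x) < d ->
      f z < f y.
Proof.
intros [Ht Hg] h1 h2.
destruct (Hg (box R0)) as [y [Hy1 [Hy2 Hy3]]].
{ apply near_plane; exists (Rmin (R0 - Rabs (fst x)) (R0 - Rabs (snd x))); split.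
  - apply Rmin_glb_lt; lra.
  - intros y H1 H2; assert (H3 := Rmin_l (R0 - Rabs (fst x)) (R0 - Rabs (snd x))).
    assert (H4 := Rmin_r (R0 - Rabs (fst x)) (R0 - Rabs (snd x))).
    assert (H5 := Rabs_triang_inv (fst y) (fst x)).
    assert (H6 := Rabs_triang_inv (snd y) (snd x)).
    split; lra. }
assert (he : 0 < f y - v) by lra.
assert (Hn := proj1 (filterlim_locally _ _) Ht (mkposreal _ he)).
apply near_plane in Hn; destruct Hn as [d [hd Hd]].
exists d, y; repeat split; auto; try apply Hy2.
intros z [Hz _] H1 H2; specialize (Hd z H1 H2 Hz).
apply Rabs_def2 in Hd; unfold minus, plus, opp in Hd; simpl in Hd; lra.
Qed.

(** The ray direction [mu] is separate from [nu] because the inner flux is measured against the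
    outward normal while moving along its opposite. *)
Lemma laplacian_at_ray_flux (w : plane -> R) (g : plane -> plane) (s : R) (x nu mu : plane) :
  laplacian_at w g s x ->
  filterlim (fun t => dot (g (plus x (scal t mu))) nu) (at_right 0) (locally (dot (g x) nu)).
Proof.
intros [_ [_ [Hg _]]]; destruct (locally_singleton _ _ Hg) as [H1 H2].
assert (Hc : continuous (fun y => fst nu * fst (g y) + snd nu * snd (g y)) x).
{ apply (continuous_plus (fun y => fst nu * fst (g y)) (fun y => snd nu * snd (g y))).
  - exact (continuous_scal_r (V := R_NormedModule) (fst nu) _ x H1).
  - exact (continuous_scal_r (V := R_NormedModule) (snd nu) _ x H2). }
assert (E : forall y, fst nu * fst (g y) + snd nu * snd (g y) = dot (g y) nu)
  by (intros y; unfold dot; ring).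
unfold continuous in Hc; rewrite E in Hc.
exact (filterlim_comp _ _ _ _ (fun y => dot (g y) nu) _ _ _ (ray_to_point x mu)
  (filterlim_ext _ _ E Hc)).
Qed.

(** * The maximum principle *)

(** For positive [a] and [b] this serves twice: as defining function of an ellipse and, its
    Laplacian being the constant [2 * a + 2 * b], as strictly subharmonic barrier. *)
Definition quad (a b : R) (x : plane) : R := a * fst x ^ 2 + b * snd x ^ 2 - 1.

Definition quad_grad (a b : R) (x : plane) : plane := (2 * a * fst x, 2 * b * snd x).

Lemma quad_laplacian_at (a b : R) (x : plane) :
  laplacian_at (quad a b) (quad_grad a b) (2 * a + 2 * b) x.
Proof.
assert (Hfst : forall y : plane, continuous (fun z : plane => fst z) y)
  by (intros [y1 y2]; apply continuous_fst).
assert (Hsnd : forall y : plane, continuous (fun z : plane => snd z) y)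
  by (intros [y1 y2]; apply continuous_snd).
split; [|split; [|split]].
- apply filter_forall; intros [y1 y2]; unfold quad, quad_grad; simpl.
  split; auto_derive; auto; ring.
- apply (continuous_minus (fun y : plane => a * fst y ^ 2 + b * snd y ^ 2) (fun _ => 1));
    [|apply continuous_const].
  apply (continuous_plus (fun y : plane => a * fst y ^ 2) (fun y : plane => b * snd y ^ 2));
  (apply (continuous_scal_r (V := R_NormedModule)); simpl).
  + apply (continuous_mult (fun y : plane => fst y) (fun y : plane => fst y * 1)); auto.
    apply (continuous_mult (fun y : plane => fst y) (fun _ => 1)); auto; apply continuous_const.
  + apply (continuous_mult (fun y : plane => snd y) (fun y : plane => snd y * 1)); auto.
    apply (continuous_mult (fun y : plane => snd y) (fun _ => 1)); auto; apply continuous_const.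
- apply filter_forall; intros y; simpl; split.
  + apply (continuous_scal_r (V := R_NormedModule) (2 * a) (fun y : plane => fst y)); auto.
  + apply (continuous_scal_r (V := R_NormedModule) (2 * b) (fun y : plane => snd y)); auto.
- exists (2 * a), (2 * b); unfold quad_grad; simpl; split; [|split; [|ring]];
  auto_derive; auto; ring.
Qed.

Lemma quad_continuous (a b : R) (x : plane) : continuous (quad a b) x.
Proof. apply (quad_laplacian_at a b x). Qed.

Lemma quad_pos_near (a b : R) (x : plane) :
  0 < quad a b x -> locally x (fun y => 0 < quad a b y).
Proof.
intros H; exact (quad_continuous a b x _ (open_gt 0 _ H)).
Qed.

Lemma quad_neg_near (a b : R) (x : plane) :
  quad a b x < 0 -> locally x (fun y => quad a b y < 0).
Proof.
intros H; exact (quad_continuous a b x _ (open_lt 0 _ H)).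
Qed.

Lemma quad_along_line (a b t : R) (x nu : plane) :
  quad a b (plus x (scal t nu)) =
  quad a b x + t * dot (quad_grad a b x) nu + t ^ 2 * (a * fst nu ^ 2 + b * snd nu ^ 2).
Proof.
unfold quad, dot, quad_grad, plus, scal; simpl; unfold plus, scal; simpl; unfold mult; simpl.
ring.
Qed.

Lemma quad_grad_continuous_ray (a b : R) (x nu : plane) :
  filterlim (fun t => dot (quad_grad a b (plus x (scal t nu))) nu) (at_right 0)
    (locally (dot (quad_grad a b x) nu)).
Proof.
assert (H : continuous (fun t => dot (quad_grad a b x) nu +
  t * (2 * a * fst nu ^ 2 + 2 * b * snd nu ^ 2)) 0).
{ apply (ex_derive_continuous (K := R_AbsRing) (V := R_NormedModule)); auto_derive; auto. }
unfold continuous in H; rewrite Rmult_0_l, Rplus_0_r in H.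
eapply filterlim_filter_le_1; [apply filter_le_within|].
eapply filterlim_ext; [|exact H].
intros t; unfold dot, quad_grad, plus, scal; simpl; unfold plus, scal; simpl; unfold mult; simpl.
ring.
Qed.

(** The second-order Taylor expansion of [quad] is exact with a nonnegative quadratic term. Hence an
    outward ray stays outside forever, while an inward one stays inside only for a short time. The
    gradient vanishes only at the origin, where [quad] is -1. *)
Lemma quad_outward_ray (a b k : R) (x nu : plane) :
  0 < a -> 0 < b -> quad a b x = 0 -> 0 < k -> quad_grad a b x = scal k nu ->
  0 < dot (quad_grad a b x) nu /\
  (forall t, 0 < t -> 0 < quad a b (plus x (scal t nu))) /\
  at_right 0 (fun t => quad a b (plus x (scal t (opp nu))) < 0).
Proof.
intros ha hb hx hk Hg.
assert (H1 : 2 * a * fst x = k * fst nu) by exact (f_equal fst Hg).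
assert (H2 : 2 * b * snd x = k * snd nu) by exact (f_equal snd Hg).
assert (hd : 0 < dot (quad_grad a b x) nu).
{ unfold dot, quad_grad; simpl; rewrite H1, H2.
  destruct (Req_dec (fst nu) 0) as [h1|h1], (Req_dec (snd nu) 0) as [h2|h2].
  - exfalso; rewrite h1, Rmult_0_r in H1; rewrite h2, Rmult_0_r in H2.
    apply Rmult_integral in H1; apply Rmult_integral in H2.
    assert (E1 : fst x = 0) by lra; assert (E2 : snd x = 0) by lra.
    unfold quad in hx; rewrite E1, E2 in hx; lra.
  - assert (0 < snd nu * snd nu) by (apply Rsqr_pos_lt in h2; exact h2).
    rewrite h1; assert (0 < k * (snd nu * snd nu)) by (apply Rmult_lt_0_compat; lra); lra.
  - assert (0 < fst nu * fst nu) by (apply Rsqr_pos_lt in h1; exact h1).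
    rewrite h2; assert (0 < k * (fst nu * fst nu)) by (apply Rmult_lt_0_compat; lra); lra.
  - assert (0 < fst nu * fst nu) by (apply Rsqr_pos_lt in h1; exact h1).
    assert (0 < snd nu * snd nu) by (apply Rsqr_pos_lt in h2; exact h2).
    assert (0 < k * (fst nu * fst nu)) by (apply Rmult_lt_0_compat; lra).
    assert (0 < k * (snd nu * snd nu)) by (apply Rmult_lt_0_compat; lra); lra. }
assert (hm : 0 <= a * fst nu ^ 2 + b * snd nu ^ 2).
{ assert (0 <= a * fst nu ^ 2) by (apply Rmult_le_pos; [lra|apply pow2_ge_0]).
  assert (0 <= b * snd nu ^ 2) by (apply Rmult_le_pos; [lra|apply pow2_ge_0]); lra. }
set (m := a * fst nu ^ 2 + b * snd nu ^ 2) in *.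
set (c := dot (quad_grad a b x) nu) in *.
split; [exact hd|split].
- intros t ht; rewrite quad_along_line, hx; fold m c.
  assert (0 < t * c) by (apply Rmult_lt_0_compat; lra).
  assert (0 <= t ^ 2 * m) by (apply Rmult_le_pos; [apply pow2_ge_0|lra]); lra.
(* Inward, [quad] equals [- t * (c - t * m)]; the bound makes [t * (m + 1) < c], and the added 1
   keeps the denominator positive. *)
- apply (eventually_at_right _ (c / (m + 1))).
  { apply Rdiv_lt_0_compat; lra. }
  intros t [ht1 ht2]; rewrite quad_along_line, hx.
  replace (dot (quad_grad a b x) (opp nu)) with (- c)
    by (unfold c, dot, opp; simpl; unfold opp; simpl; ring).
  change (fst (opp nu)) with (- fst nu); change (snd (opp nu)) with (- snd nu).
  assert (t * (m + 1) < c).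
  { apply Rmult_lt_reg_r with (/ (m + 1)); [apply Rinv_0_lt_compat; lra|].
    replace (t * (m + 1) * / (m + 1)) with t by (field; lra); exact ht2. }
  replace (0 + t * - c + t ^ 2 * (a * (- fst nu) ^ 2 + b * (- snd nu) ^ 2))
    with (- (t * (c - t * m))) by (unfold m; ring).
  assert (0 < t * (c - t * m)) by (apply Rmult_lt_0_compat; lra); lra.
Qed.

Lemma quad_nested (a b a' b' : R) (x : plane) :
  0 < a' < a -> 0 < b' < b -> 0 <= quad a' b' x -> 0 < quad a b x.
Proof.
intros ha hb Hx; unfold quad in *.
assert (0 <= fst x ^ 2) by apply pow2_ge_0.
assert (0 <= snd x ^ 2) by apply pow2_ge_0.
assert (a' * fst x ^ 2 <= a * fst x ^ 2) by (apply Rmult_le_compat_r; lra).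
assert (b' * snd x ^ 2 <= b * snd x ^ 2) by (apply Rmult_le_compat_r; lra).
destruct (Req_dec (fst x ^ 2) 0) as [h1|h1].
- destruct (Req_dec (snd x ^ 2) 0) as [h2|h2].
  + rewrite h1, h2 in *; lra.
  + assert (b' * snd x ^ 2 < b * snd x ^ 2) by (apply Rmult_lt_compat_r; lra); lra.
- assert (a' * fst x ^ 2 < a * fst x ^ 2) by (apply Rmult_lt_compat_r; lra); lra.
Qed.

Lemma continuous_Rmax_0 (f : plane -> R) (x : plane) :
  continuous f x -> continuous (fun y => Rmax 0 (f y)) x.
Proof.
intros H.
apply continuous_ext with (fun y => / 2 * (f y + Rabs (f y))).
- intros y; unfold Rmax; destruct (Rle_dec 0 (f y)).
  + rewrite Rabs_right; lra.
  + rewrite Rabs_left; lra.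
- apply (continuous_scal_r (V := R_NormedModule) (/ 2)).
  apply (continuous_plus f (fun y => Rabs (f y))); [exact H|].
  apply (continuous_comp f Rabs); [exact H|apply continuous_Rabs].
Qed.

Lemma is_trace_continuous (U : plane -> Prop) (f : plane -> R) (x : plane) :
  continuous f x -> is_trace U f x (f x).
Proof. intros H; eapply filterlim_filter_le_1; [|exact H]; apply filter_le_within. Qed.

Lemma is_trace_combine (U : plane -> Prop) (c : R) (f h : plane -> R) (x : plane) (u v : R) :
  is_trace U f x u -> is_trace U h x v -> is_trace U (fun y => f y + c * h y) x (u + c * v).
Proof.
intros Hf Hh.
assert (Hh' : filterlim (fun y => c * h y) (within U (locally x)) (locally (c * v)))
  by exact (filterlim_comp _ _ _ h (fun z => c * z) _ _ _ Hh
    (filterlim_scal_r (V := R_NormedModule) c v)).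
exact (filterlim_comp_2 f (fun y => c * h y) Rplus Hf Hh'
  (filterlim_plus (V := R_NormedModule) u (c * v))).
Qed.

Lemma filterlim_ray_combine (c : R) (g h : plane -> plane) (x nu mu : plane) (u v : R) :
  filterlim (fun t => dot (g (plus x (scal t mu))) nu) (at_right 0) (locally u) ->
  filterlim (fun t => dot (h (plus x (scal t mu))) nu) (at_right 0) (locally v) ->
  filterlim (fun t => dot (plus (g (plus x (scal t mu))) (scal c (h (plus x (scal t mu))))) nu)
    (at_right 0) (locally (u + c * v)).
Proof.
intros Hu Hv.
assert (Hv' : filterlim (fun t => c * dot (h (plus x (scal t mu))) nu) (at_right 0)
  (locally (c * v))).
{ eapply filterlim_comp; [exact Hv|apply (filterlim_scal_r (V := R_NormedModule))]. }
eapply filterlim_ext; [|exact (filterlim_comp_2 _ _ Rplus Hu Hv'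
  (filterlim_plus (V := R_NormedModule) u (c * v)))].
intros t; unfold dot, plus, scal; simpl; unfold plus, scal; simpl; unfold mult; simpl; ring.
Qed.

Lemma is_trace_union (U V W : plane -> Prop) (f : plane -> R) (x : plane) (v : R) :
  (forall y, U y -> V y \/ W y) ->
  is_trace V f x v -> is_trace W f x v -> is_trace U f x v.
Proof.
intros H HV HW P HP; specialize (HV P HP); specialize (HW P HP).
unfold filtermap, within in *; generalize (filter_and _ _ HV HW); apply filter_imp.
intros y [H1 H2] Hy; destruct (H y Hy); auto.
Qed.

Lemma is_trace_subset (U V : plane -> Prop) (f : plane -> R) (x : plane) (v : R) :
  (forall y, U y -> V y) -> is_trace V f x v -> is_trace U f x v.
Proof. intros H HV; apply (is_trace_union U V V); auto. Qed.

Lemma plus_scal_origin (c : R) (x : plane) : plus x (scal c (0, 0)) = x.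
Proof.
destruct x; apply injective_projections; unfold plus, scal; simpl; unfold plus, scal; simpl;
unfold mult; simpl; ring.
Qed.

(** With [b] the barrier [quad a b + max 0 (quad a' b')], no [w + eps b] with [eps > 0] has a
    local maximum: [b] is strictly subharmonic off the interface, its normal derivative is
    positive on the inner ellipse, and jumps upwards across the outer one. *)
Lemma transmission_maximum_principle (a b a' b' : R) (w : plane -> R) (g : plane -> plane) :
  0 < a' < a -> 0 < b' < b ->
  (forall x, 0 < quad a b x -> quad a' b' x <> 0 -> laplacian_at w g 0 x) ->
  (forall x, quad a b x = 0 -> exists (v : R) (nu : plane) (k : R),
     0 < k /\ quad_grad a b x = scal k nu /\
     is_trace (fun y => 0 < quad a b y) w x v /\
     filterlim (fun t => dot (g (plus x (scal t nu))) nu) (at_right 0) (locally 0)) ->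
  (forall x, quad a' b' x = 0 -> exists (v d : R) (nu : plane) (k : R),
     0 < k /\ quad_grad a' b' x = scal k nu /\
     is_trace (fun y => 0 < quad a' b' y) w x v /\
     is_trace (fun y => quad a' b' y < 0 /\ 0 < quad a b y) w x v /\
     filterlim (fun t => dot (g (plus x (scal t nu))) nu) (at_right 0) (locally d) /\
     filterlim (fun t => dot (g (plus x (scal t (opp nu)))) nu) (at_right 0) (locally d)) ->
  (forall e, 0 < e -> exists r, forall x, 0 < quad a b x -> quad a' b' x <> 0 ->
     r < Rabs (fst x) \/ r < Rabs (snd x) -> w x <= e) ->
  forall x, 0 < quad a b x -> quad a' b' x <> 0 -> w x <= 0.
Proof.
intros [ha' ha] [hb' hb] Hlap Hin Hout Hdec x0 Hx0 Hx0'.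
destruct (Rle_or_lt (w x0) 0) as [h0|h0]; [exact h0|exfalso].
destruct (Hdec (w x0 / 2)) as [r Hr]; [lra|].
set (R1 := Rmax 0 (Rmax r (Rmax (Rabs (fst x0)) (Rabs (snd x0))))).
assert (0 <= R1 /\ r <= R1 /\ Rabs (fst x0) <= R1 /\ Rabs (snd x0) <= R1)
  as (hR0 & hRr & hR1 & hR2).
{ unfold R1; repeat split.
  - apply Rmax_l.
  - eapply Rle_trans; [apply Rmax_l|apply Rmax_r].
  - eapply Rle_trans; [apply Rmax_l|eapply Rle_trans; [apply Rmax_r|apply Rmax_r]].
  - eapply Rle_trans; [apply Rmax_r|eapply Rle_trans; [apply Rmax_r|apply Rmax_r]]. }
(* The margin 1 keeps the points of the region within distance 1 of the edge of the box beyond [r],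
   where [w] is at most [w x0 / 2]. *)
set (R0 := R1 + 1).
set (B := fun x => quad a b x + 1 * Rmax 0 (quad a' b' x)).
(* On the outer ellipse, where [B] has a kink, [gB] takes the inner gradient by default; it is
   consulted only on the two open sides. The coefficient 1 matches the shape of
   [laplacian_at_combine]. *)
set (gB := fun x => plus (quad_grad a b x)
   (scal 1 (if Rlt_dec 0 (quad a' b' x) then quad_grad a' b' x else (0, 0)))).
assert (HgBneg : forall y, quad a' b' y < 0 -> gB y = quad_grad a b y).
{ intros y Hy; unfold gB; destruct (Rlt_dec 0 (quad a' b' y)); [lra|apply plus_scal_origin]. }
assert (HgBpos : forall y, 0 < quad a' b' y ->
  gB y = plus (quad_grad a b y) (scal 1 (quad_grad a' b' y))).
{ intros y Hy; unfold gB; destruct (Rlt_dec 0 (quad a' b' y)); [reflexivity|lra]. }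
assert (HBc : forall x, continuous B x).
{ intros x; apply (continuous_plus (quad a b) (fun x => 1 * Rmax 0 (quad a' b' x))).
  - apply quad_continuous.
  - apply (continuous_scal_r (V := R_NormedModule) 1), continuous_Rmax_0, quad_continuous. }
assert (HBlap : forall x, quad a' b' x <> 0 -> exists s, 0 < s /\ laplacian_at B gB s x).
{ intros x Hx; destruct (Rlt_or_le 0 (quad a' b' x)) as [hx|hx].
  - exists (2 * a + 2 * b + 1 * (2 * a' + 2 * b')); split; [lra|].
    apply laplacian_at_ext with (2 := laplacian_at_combine 1 _ _ _ _ _ _ _
       (quad_laplacian_at a b x) (quad_laplacian_at a' b' x)).
    generalize (quad_pos_near _ _ _ hx); apply filter_imp; intros y hy; unfold B; split.
    + rewrite Rmax_right; lra.
    + symmetry; exact (HgBpos y hy).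
  - exists (2 * a + 2 * b); split; [lra|].
    apply laplacian_at_ext with (2 := quad_laplacian_at a b x).
    assert (hx' : quad a' b' x < 0) by lra.
    generalize (quad_neg_near _ _ _ hx'); apply filter_imp; intros y hy; unfold B; split.
    + rewrite Rmax_left; lra.
    + symmetry; exact (HgBneg y hy). }
set (M := (a + b + a' + b') * R0 ^ 2).
assert (HM : 0 <= M).
{ apply Rmult_le_pos; [lra|apply pow2_ge_0]. }
assert (HBM : forall x, box R0 x -> B x <= M).
{ intros x [h1 h2].
  assert (E1 : fst x ^ 2 <= R0 ^ 2).
  { rewrite <- (pow2_abs (fst x)); apply pow_incr; split; [apply Rabs_pos|exact h1]. }
  assert (E2 : snd x ^ 2 <= R0 ^ 2).
  { rewrite <- (pow2_abs (snd x)); apply pow_incr; split; [apply Rabs_pos|exact h2]. }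
  assert (E0 := pow2_ge_0 R0).
  assert (a * fst x ^ 2 <= a * R0 ^ 2) by (apply Rmult_le_compat_l; lra).
  assert (b * snd x ^ 2 <= b * R0 ^ 2) by (apply Rmult_le_compat_l; lra).
  assert (a' * fst x ^ 2 <= a' * R0 ^ 2) by (apply Rmult_le_compat_l; lra).
  assert (b' * snd x ^ 2 <= b' * R0 ^ 2) by (apply Rmult_le_compat_l; lra).
  assert (0 <= a' * R0 ^ 2) by (apply Rmult_le_pos; lra).
  assert (0 <= b' * R0 ^ 2) by (apply Rmult_le_pos; lra).
  assert (Rmax 0 (quad a' b' x) <= a' * R0 ^ 2 + b' * R0 ^ 2)
    by (apply Rmax_lub; unfold quad; lra).
  unfold B, M; unfold quad at 1; lra. }
(* Chosen so that near the edge [w + e * B] is at most [w x0 / 2 + w x0 / 4], which is below its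
   value at [x0]; the 1 avoids a division by zero. *)
set (e := w x0 / (4 * (M + 1))).
assert (he : 0 < e) by (apply Rdiv_lt_0_compat; lra).
assert (heM : e * M <= w x0 / 4).
{ unfold e; apply Rmult_le_reg_r with (4 * (M + 1)); [lra|].
  replace (w x0 / (4 * (M + 1)) * M * (4 * (M + 1))) with (w x0 * M) by (field; lra).
  replace (w x0 / 4 * (4 * (M + 1))) with (w x0 * M + w x0) by field; lra. }
set (U := fun x => 0 < quad a b x /\ quad a' b' x <> 0).
set (f := fun x => w x + e * B x).
set (gf := fun x => plus (g x) (scal e (gB x))).
assert (Hf : forall x, exists s, U x -> 0 < s /\ laplacian_at f gf s x).
{ intros x; destruct (classic (U x)) as [[Hx1 Hx2]|Hx]; [|exists 0; intros H; contradiction].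
  destruct (HBlap x Hx2) as [s [hs Hs]]; exists (0 + e * s); intros _; split.
  - assert (0 < e * s) by (apply Rmult_lt_0_compat; lra); lra.
  - apply laplacian_at_combine; auto. }
destruct (choice _ Hf) as [s Hs]; clear Hf.
assert (HfU : forall y, U y -> U y /\ laplacian_at f gf (s y) y)
  by (intros y Hy; split; [exact Hy|apply (Hs y Hy)]).
assert (HUopen : forall x, U x -> locally x U).
{ intros x [H1 H2]; destruct (Rlt_or_le 0 (quad a' b' x)) as [h|h].
  - generalize (filter_and _ _ (quad_pos_near _ _ _ H1) (quad_pos_near _ _ _ h)).
    apply filter_imp; intros y [h1 h2]; split; lra.
  - assert (h' : quad a' b' x < 0) by lra.
    generalize (filter_and _ _ (quad_pos_near _ _ _ H1) (quad_neg_near _ _ _ h')).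
    apply filter_imp; intros y [h1 h2]; split; lra. }
assert (Hnest : forall x, quad a b x <= 0 -> quad a' b' x < 0).
{ intros x Hx; apply Rnot_le_lt; intros h.
  assert (Hn := quad_nested a b a' b' x (conj ha' ha) (conj hb' hb) h); lra. }
apply (no_escape_from_box R0 (fun x => U x /\ box R0 x) f) with (x := x0).
- intros x [_ H]; exact H.
- intros x Hx.
  destruct (classic (Rabs (fst x) < R0 /\ Rabs (snd x) < R0)) as [[h1 h2]|Hedge].
  + assert (Hesc : forall v, growth_point U f x v -> exists d y, 0 < d /\ (U y /\ box R0 y) /\
      forall z, U z /\ box R0 z -> Rabs (fst z - fst x) < d -> Rabs (snd z - snd x) < d ->
      f z < f y) by (intros v Hv; apply escape_at_growth_point with v; auto).
    destruct (Rtotal_order (quad a b x) 0) as [hq|[hq|hq]].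
    (* Inside the inner ellipse no point of [U] is near, so the condition is vacuous and [x0] is a
       witness. *)
    * destruct (proj1 (near_plane _ _) (quad_neg_near _ _ _ hq)) as [d [hd Hd]].
      exists d, x0; split; [exact hd|split; [repeat split; unfold R0; auto; lra|]].
      intros z [[Hz _] _] h3 h4; specialize (Hd z h3 h4); lra.
    * destruct (Hin x hq) as [v [nu [k [hk [Hk [Hv Hn]]]]]].
      destruct (quad_outward_ray a b k x nu) as [hd [Hpos _]]; auto; try lra.
      assert (hq' : quad a' b' x < 0) by (apply Hnest; lra).
      assert (Hneg := ray_eventually x nu _ (quad_neg_near _ _ _ hq')).
      apply (Hesc (v + e * B x)).
      apply (growth_along_inner_ray U U f gf s x nu _ (0 + e * dot (quad_grad a b x) nu) HfU).
      -- apply is_trace_combine; [|apply is_trace_continuous, HBc].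
         apply is_trace_subset with (2 := Hv); intros y [H _]; exact H.
      -- apply filter_imp with (2 := filter_and _ _ Hneg
           (eventually_at_right (fun t => 0 < t) 1 Rlt_0_1 (fun t Ht => proj1 Ht))).
         intros t [H1 H2]; split; [apply Hpos; exact H2|lra].
      -- apply filterlim_ray_combine; [exact Hn|].
         eapply filterlim_ext_loc; [|apply quad_grad_continuous_ray].
         generalize Hneg; apply filter_imp; intros t Ht.
         exact (f_equal (fun u => dot u nu) (eq_sym (HgBneg _ Ht))).
      -- assert (0 < e * dot (quad_grad a b x) nu) by (apply Rmult_lt_0_compat; lra); lra.
    * destruct (Req_dec (quad a' b' x) 0) as [hq'|hq'].
      -- destruct (Hout x hq') as [v [d [nu [k [hk [Hk [Hvp [Hvm [Hdp Hdm]]]]]]]]].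
         destruct (quad_outward_ray a' b' k x nu) as [hd [Hpos Hneg]]; auto.
         assert (HtU : is_trace U f x (v + e * B x)).
         { apply is_trace_combine; [|apply is_trace_continuous, HBc].
           apply is_trace_union with (2 := Hvp) (3 := Hvm).
           intros y [H1 H2]; destruct (Rtotal_order (quad a' b' y) 0) as [H|[H|H]]; auto.
           contradiction. }
         set (c := dot (quad_grad a b x) nu).
         set (c' := dot (quad_grad a' b' x) nu) in *.
         apply (Hesc (v + e * B x)).
         (* The outward derivative of [f] is [d + e * (c + c')] and the inward one is
            [- (d + e * c)]. Their sum [e * c'] is positive, so [f] grows in at least one of the two
            directions. *)
         destruct (Rlt_or_le 0 (d + e * (c + 1 * c'))) as [hL|hL].
         ++ apply (growth_along_inner_ray U U f gf s x nu _ (d + e * (c + 1 * c')) HfU HtU);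
              [| |exact hL].
            ** generalize (filter_and _ _ (ray_eventually x nu _ (quad_pos_near _ _ _ hq))
                 (eventually_at_right (fun t => 0 < t) 1 Rlt_0_1 (fun t Ht => proj1 Ht))).
               apply filter_imp; intros t [H1 H2]; split; [exact H1|].
               specialize (Hpos t H2); lra.
            ** apply filterlim_ray_combine; [exact Hdp|].
               eapply filterlim_ext_loc; [|apply (filterlim_ray_combine 1
                  (quad_grad a b) (quad_grad a' b') x nu nu c c');
                  apply quad_grad_continuous_ray].
               apply (eventually_at_right _ 1 Rlt_0_1); intros t Ht.
               exact (f_equal (fun u => dot u nu) (eq_sym (HgBpos _ (Hpos t (proj1 Ht))))).
         ++ assert (hc' : 0 < e * c') by (apply Rmult_lt_0_compat; lra).
            assert (Eopp : forall u, dot u (opp nu) = -1 * dot u nu)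
              by (intros u; unfold dot, opp; simpl; unfold opp; simpl; ring).
            apply (growth_along_inner_ray U U f gf s x (opp nu) _ (-1 * d + e * (-1 * c))
              HfU HtU).
            ** generalize (filter_and _ _ Hneg
                 (ray_eventually x (opp nu) _ (quad_pos_near _ _ _ hq))).
               apply filter_imp; intros t [H1 H2]; split; [exact H2|lra].
            ** apply filterlim_ray_combine.
               --- eapply filterlim_ext; [intros t; symmetry; apply Eopp|].
                   eapply filterlim_comp; [exact Hdm|].
                   apply (filterlim_scal_r (V := R_NormedModule)).
               --- replace (-1 * c) with (dot (quad_grad a b x) (opp nu))
                     by (rewrite Eopp; reflexivity).
                   eapply filterlim_ext_loc; [|apply quad_grad_continuous_ray].
                   generalize Hneg; apply filter_imp; intros t Ht.
                   exact (f_equal (fun u => dot u (opp nu)) (eq_sym (HgBneg _ Ht))).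
            ** lra.
      -- assert (HxU : U x) by (split; assumption).
         destruct (Hs x HxU) as [hs Hlx].
         apply (Hesc (f x)).
         apply growth_at_interior with gf (s x); auto.
  + exists 1, x0; split; [lra|split; [repeat split; unfold R0; auto; lra|]].
    intros z [[Hz1 Hz2] Hz3] h1 h2.
    assert (Hz : w z <= w x0 / 2).
    { apply Hr; auto.
      assert (H1 := Rabs_triang_inv (fst x) (fst z)).
      assert (H2 := Rabs_triang_inv (snd x) (snd z)).
      rewrite Rabs_minus_sym in h1, h2.
      unfold R0 in Hedge.
      destruct (Rlt_or_le (Rabs (fst x)) (R1 + 1)); [|left; lra].
      destruct (Rlt_or_le (Rabs (snd x)) (R1 + 1)); [|right; lra].
      exfalso; apply Hedge; auto. }
    assert (HBz := HBM z Hz3).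
    assert (e * B z <= e * M) by (apply Rmult_le_compat_l; lra).
    assert (0 < e * B x0).
    { apply Rmult_lt_0_compat; [exact he|].
      unfold B; assert (Hm := Rmax_l 0 (quad a' b' x0)); lra. }
    unfold f; lra.
- split; [split; assumption|split; unfold R0; lra].
Qed.

(** * Confocal ellipses *)

Lemma cosh2_sinh2 (x : R) : cosh x ^ 2 = 1 + sinh x ^ 2.
Proof.
unfold cosh, sinh.
assert (H : exp x * exp (- x) = 1) by (rewrite <- exp_plus, Rplus_opp_r; apply exp_0).
replace (((exp x + exp (- x)) / 2) ^ 2)
  with (((exp x - exp (- x)) / 2) ^ 2 + exp x * exp (- x)) by field.
rewrite H; ring.
Qed.

Lemma cosh_pos (x : R) : 0 < cosh x.
Proof. unfold cosh; assert (H := exp_pos x); assert (H' := exp_pos (- x)); lra. Qed.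

Lemma sinh_pos (x : R) : 0 < x -> 0 < sinh x.
Proof. intros H; rewrite <- sinh_0; apply sinh_lt, H. Qed.

Lemma sinh_nonneg (x : R) : 0 <= x -> 0 <= sinh x.
Proof. intros [H|<-]; [left; apply sinh_pos, H|right; symmetry; apply sinh_0]. Qed.

Lemma sinh2_lt (x y : R) : 0 <= x < y -> sinh x ^ 2 < sinh y ^ 2.
Proof.
intros H; assert (H1 := sinh_nonneg x (proj1 H)); assert (H2 := sinh_lt x y (proj2 H)).
simpl; rewrite !Rmult_1_r; apply Rmult_le_0_lt_compat; lra.
Qed.

Lemma unit_vector_angle (c s : R) :
  c ^ 2 + s ^ 2 = 1 -> exists eta, 0 <= eta <= 2 * PI /\ cos eta = c /\ sin eta = s.
Proof.
intros H.
assert (hs2 := pow2_ge_0 s); assert (hc2 := pow2_ge_0 c).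
assert (hc : -1 <= c <= 1) by (split; apply Rnot_lt_le; intros h; nra).
assert (hb := acos_bound c).
assert (Hsin : sin (acos c) = Rabs s).
{ rewrite sin_acos by exact hc.
  replace (1 - Rsqr c) with (Rsqr s) by (unfold Rsqr; simpl in H; lra).
  apply sqrt_Rsqr_abs. }
destruct (Rle_or_lt 0 s) as [h|h].
- exists (acos c); split; [lra|split; [apply cos_acos, hc|]].
  rewrite Hsin; apply Rabs_right; lra.
- exists (2 * PI - acos c); split; [lra|split].
  + rewrite cos_minus, cos_2PI, sin_2PI, cos_acos by exact hc; ring.
  + rewrite sin_minus, cos_2PI, sin_2PI, Hsin, Rabs_left by exact h; ring.
Qed.

Lemma elliptic_surjective (l : R) (x : plane) :
  0 < l -> exists xi eta, 0 <= xi /\ 0 <= eta <= 2 * PI /\ x = elliptic l xi eta.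
Proof.
destruct x as [x1 x2]; intros hl.
(* [S], the value of [sinh xi ^ 2], is the nonnegative root of
   [l^2 S^2 + (l^2 - x1^2 - x2^2) S - x2^2]. *)
set (r := x1 ^ 2 + x2 ^ 2 - l ^ 2).
set (Dl := r ^ 2 + 4 * l ^ 2 * x2 ^ 2).
assert (hl2 : 0 < l ^ 2) by (apply pow_lt, hl).
assert (h1 := pow2_ge_0 x1); assert (h2 := pow2_ge_0 x2).
assert (hD : 0 <= Dl).
{ unfold Dl; assert (H := pow2_ge_0 r).
  assert (0 <= 4 * l ^ 2 * x2 ^ 2) by (apply Rmult_le_pos; lra); lra. }
set (S := (r + sqrt Dl) / (2 * l ^ 2)).
assert (hS : l ^ 2 * S ^ 2 = r * S + x2 ^ 2).
{ assert (E : sqrt Dl * sqrt Dl = Dl) by (apply sqrt_sqrt, hD).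
  assert (hT : 2 * l ^ 2 * S = r + sqrt Dl) by (unfold S; field; lra).
  apply Rmult_eq_reg_l with (4 * l ^ 2); [|lra].
  replace (4 * l ^ 2 * (l ^ 2 * S ^ 2)) with ((2 * l ^ 2 * S) ^ 2) by ring.
  replace (4 * l ^ 2 * (r * S + x2 ^ 2))
    with (2 * r * (2 * l ^ 2 * S) + 4 * l ^ 2 * x2 ^ 2) by ring.
  rewrite hT.
  replace ((r + sqrt Dl) ^ 2) with (r ^ 2 + 2 * r * sqrt Dl + sqrt Dl * sqrt Dl) by ring.
  rewrite E; unfold Dl; ring. }
assert (hS0 : 0 <= S).
{ apply Rmult_le_pos; [|left; apply Rinv_0_lt_compat; lra].
  assert (Rabs r <= sqrt Dl).
  { rewrite <- sqrt_Rsqr_abs; apply sqrt_le_1_alt; unfold Dl, Rsqr.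
    assert (0 <= 4 * l ^ 2 * x2 ^ 2) by (apply Rmult_le_pos; lra); simpl; lra. }
  assert (H' := Rabs_maj2 r); lra. }
set (xi := arcsinh (sqrt S)).
assert (hsh : sinh xi = sqrt S) by apply sinh_arcsinh.
assert (hsh2 : sinh xi ^ 2 = S) by (rewrite hsh; apply pow2_sqrt, hS0).
assert (hch2 : cosh xi ^ 2 = 1 + S) by (rewrite cosh2_sinh2, hsh2; reflexivity).
assert (hxi : 0 <= xi).
{ destruct (Rle_or_lt 0 xi) as [h|h]; [exact h|exfalso].
  apply sinh_lt in h; rewrite sinh_0, hsh in h; assert (H := sqrt_pos S); lra. }
assert (hch := cosh_pos xi).
assert (hlc : l * cosh xi <> 0) by (apply Rmult_integral_contrapositive_currified; lra).
(* [S = 0] is the focal segment: there [sinh xi] vanishes, so [sin eta] cannot be read off from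
   [x2]. Instead [cos eta] is taken to be [x1 / l], which lies in [-1, 1] because [r] is at most
   0. *)
destruct (Req_dec S 0) as [hz|hz].
- assert (hx2 : x2 ^ 2 = 0) by (rewrite hz in hS; simpl in hS; simpl; lra).
  assert (hx2' : x2 = 0) by (apply Rsqr_0_uniq; unfold Rsqr; simpl in hx2; lra).
  assert (hs0 : sinh xi = 0) by (rewrite hsh, hz; apply sqrt_0).
  assert (hc1 : cosh xi = 1).
  { rewrite hz in hch2; apply Rsqr_inj; [lra|lra|unfold Rsqr; simpl in hch2; lra]. }
  assert (hr : r <= 0).
  { assert (H := sqrt_pos Dl); unfold S in hz.
    assert (H' : r + sqrt Dl = 0).
    { apply Rmult_integral in hz; destruct hz as [hz|hz]; [exact hz|exfalso].
      assert (0 < / (2 * l ^ 2)) by (apply Rinv_0_lt_compat; lra); lra. }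
    lra. }
  set (c := x1 / l).
  assert (hc : c ^ 2 <= 1).
  { unfold c; replace ((x1 / l) ^ 2) with (x1 ^ 2 / l ^ 2) by (field; lra).
    apply Rmult_le_reg_r with (l ^ 2); [lra|].
    replace (x1 ^ 2 / l ^ 2 * l ^ 2) with (x1 ^ 2) by (field; lra).
    unfold r in hr; lra. }
  destruct (unit_vector_angle c (sqrt (1 - c ^ 2))) as [eta [He1 [He2 He3]]].
  { rewrite pow2_sqrt by lra; ring. }
  exists xi, eta; split; [exact hxi|split; [exact He1|]].
  unfold elliptic; rewrite He2, hs0, hc1, hx2'; f_equal; unfold c; field; lra.
- assert (hs0 : 0 < sinh xi) by (rewrite hsh; apply sqrt_lt_R0; lra).
  destruct (unit_vector_angle (x1 / (l * cosh xi)) (x2 / (l * sinh xi)))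
    as [eta [He1 [He2 He3]]].
  { replace ((x1 / (l * cosh xi)) ^ 2) with (x1 ^ 2 / (l ^ 2 * (cosh xi) ^ 2)) by (field; lra).
    replace ((x2 / (l * sinh xi)) ^ 2) with (x2 ^ 2 / (l ^ 2 * (sinh xi) ^ 2)) by (field; lra).
    rewrite hsh2, hch2.
    assert (hp : 0 < l ^ 2 * (1 + S)) by (apply Rmult_lt_0_compat; lra).
    assert (hp' : 0 < l ^ 2 * (1 + S) * S) by (apply Rmult_lt_0_compat; lra).
    apply Rmult_eq_reg_r with (l ^ 2 * (1 + S) * S); [|lra].
    field_simplify; [|repeat split; lra].
    unfold r in hS; lra. }
  exists xi, eta; split; [exact hxi|split; [exact He1|]].
  unfold elliptic; rewrite He2, He3; f_equal; field; lra.
Qed.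

(** [quad (ell_a l xi0) (ell_b l xi0)] vanishes exactly on the ellipse [xi = xi0]. *)
Definition ell_a (l xi0 : R) : R := / (l * cosh xi0) ^ 2.
Definition ell_b (l xi0 : R) : R := / (l * sinh xi0) ^ 2.

Lemma ell_a_pos (l xi0 : R) : 0 < l -> 0 < ell_a l xi0.
Proof.
intros hl; apply Rinv_0_lt_compat, pow_lt, Rmult_lt_0_compat; [exact hl|apply cosh_pos].
Qed.

Lemma ell_b_pos (l xi0 : R) : 0 < l -> 0 < xi0 -> 0 < ell_b l xi0.
Proof.
intros hl h; apply Rinv_0_lt_compat, pow_lt, Rmult_lt_0_compat; [exact hl|apply sinh_pos, h].
Qed.

Lemma ell_a_lt (l x y : R) : 0 < l -> 0 < x < y -> ell_a l y < ell_a l x.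
Proof.
intros hl [hx hxy]; unfold ell_a.
assert (hl2 : 0 < l ^ 2) by (apply pow_lt, hl).
assert (hc := pow_lt _ 2 (cosh_pos x)); assert (hc' := pow_lt _ 2 (cosh_pos y)).
assert (hs : sinh x ^ 2 < sinh y ^ 2) by (apply sinh2_lt; lra).
rewrite !Rpow_mult_distr; apply Rinv_lt_contravar.
- apply Rmult_lt_0_compat; apply Rmult_lt_0_compat; assumption.
- apply Rmult_lt_compat_l; [exact hl2|]; rewrite !cosh2_sinh2; lra.
Qed.

Lemma ell_b_lt (l x y : R) : 0 < l -> 0 < x < y -> ell_b l y < ell_b l x.
Proof.
intros hl [hx hxy]; unfold ell_b.
assert (hl2 : 0 < l ^ 2) by (apply pow_lt, hl).
assert (hc := pow_lt _ 2 (sinh_pos x hx)).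
assert (hc' : 0 < sinh y ^ 2) by (apply pow_lt, sinh_pos; lra).
assert (hs : sinh x ^ 2 < sinh y ^ 2) by (apply sinh2_lt; lra).
rewrite !Rpow_mult_distr; apply Rinv_lt_contravar.
- apply Rmult_lt_0_compat; apply Rmult_lt_0_compat; assumption.
- apply Rmult_lt_compat_l; [exact hl2|exact hs].
Qed.

Lemma cos2_sin2 (eta : R) : cos eta ^ 2 + sin eta ^ 2 = 1.
Proof. assert (H := sin2_cos2 eta); unfold Rsqr in H; simpl; lra. Qed.

(** Confocality is what makes this factor: from [xi0] to [xi], [sinh ^ 2] and [cosh ^ 2] change by
    the same amount. The second factor is positive, so the sign only depends on [xi]. *)
Lemma quad_elliptic (l xi0 xi eta : R) :
  0 < l -> 0 < xi0 ->
  quad (ell_a l xi0) (ell_b l xi0) (elliptic l xi eta) =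
  (sinh xi ^ 2 - sinh xi0 ^ 2) *
  (cos eta ^ 2 / cosh xi0 ^ 2 + sin eta ^ 2 / sinh xi0 ^ 2).
Proof.
intros hl h0; assert (hc := cosh_pos xi0); assert (hs := sinh_pos xi0 h0).
unfold quad, ell_a, ell_b, elliptic; simpl fst; simpl snd.
transitivity (cosh xi ^ 2 * cos eta ^ 2 / cosh xi0 ^ 2 + sinh xi ^ 2 * sin eta ^ 2 / sinh xi0 ^ 2
   - (cos eta ^ 2 + sin eta ^ 2)).
- rewrite cos2_sin2; field; lra.
- assert (E : sinh xi ^ 2 = cosh xi ^ 2 - 1) by (rewrite cosh2_sinh2; ring).
  assert (E0 : sinh xi0 ^ 2 = cosh xi0 ^ 2 - 1) by (rewrite cosh2_sinh2; ring).
  rewrite Rmult_plus_distr_l.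
  replace ((sinh xi ^ 2 - sinh xi0 ^ 2) * (cos eta ^ 2 / cosh xi0 ^ 2)) with
    ((cosh xi ^ 2 - cosh xi0 ^ 2) * (cos eta ^ 2 / cosh xi0 ^ 2)) by (rewrite E, E0; ring).
  field; lra.
Qed.

Lemma quad_elliptic_sign (l xi0 xi eta : R) :
  0 < l -> 0 < xi0 -> 0 <= xi ->
  (quad (ell_a l xi0) (ell_b l xi0) (elliptic l xi eta) < 0 <-> xi < xi0) /\
  (quad (ell_a l xi0) (ell_b l xi0) (elliptic l xi eta) = 0 <-> xi = xi0) /\
  (0 < quad (ell_a l xi0) (ell_b l xi0) (elliptic l xi eta) <-> xi0 < xi).
Proof.
intros hl h0 hx; rewrite quad_elliptic by assumption.
set (m := cos eta ^ 2 / cosh xi0 ^ 2 + sin eta ^ 2 / sinh xi0 ^ 2).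
assert (hm : 0 < m).
{ assert (hc := pow_lt _ 2 (cosh_pos xi0)); assert (hs := pow_lt _ 2 (sinh_pos xi0 h0)).
  assert (h1 := pow2_ge_0 (cos eta)); assert (h2 := pow2_ge_0 (sin eta)).
  assert (h3 := cos2_sin2 eta).
  assert (i1 := Rinv_0_lt_compat _ hc); assert (i2 := Rinv_0_lt_compat _ hs).
  unfold m, Rdiv.
  assert (0 <= cos eta ^ 2 * / cosh xi0 ^ 2) by (apply Rmult_le_pos; lra).
  destruct (Rlt_or_le 0 (sin eta ^ 2)) as [h|h].
  - assert (0 < sin eta ^ 2 * / sinh xi0 ^ 2) by (apply Rmult_lt_0_compat; lra); lra.
  - assert (0 < cos eta ^ 2 * / cosh xi0 ^ 2) by (apply Rmult_lt_0_compat; lra).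
    assert (0 <= sin eta ^ 2 * / sinh xi0 ^ 2) by (apply Rmult_le_pos; lra); lra. }
destruct (Rtotal_order xi xi0) as [h|[h|h]].
- assert (H := sinh2_lt xi xi0 (conj hx h)).
  assert (0 < (sinh xi0 ^ 2 - sinh xi ^ 2) * m) by (apply Rmult_lt_0_compat; lra).
  repeat split; intros; lra.
- rewrite h; repeat split; intros; lra.
- assert (H : sinh xi0 ^ 2 < sinh xi ^ 2) by (apply sinh2_lt; lra).
  assert (0 < (sinh xi ^ 2 - sinh xi0 ^ 2) * m) by (apply Rmult_lt_0_compat; lra).
  repeat split; intros; lra.
Qed.

Lemma elliptic_domain_quad (l xi0 : R) (x : plane) :
  0 < l -> 0 < xi0 ->
  elliptic_domain l xi0 x <-> quad (ell_a l xi0) (ell_b l xi0) x < 0.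
Proof.
intros hl h0; split.
- intros [xi [eta [[h1 h2] [_ ->]]]]; apply quad_elliptic_sign; assumption.
- destruct (elliptic_surjective l x hl) as [xi [eta [h1 [h2 ->]]]]; intros H.
  apply quad_elliptic_sign in H; auto; exists xi, eta; auto.
Qed.

Lemma norm_Cmod (x : plane) : norm x = Cmod x.
Proof.
change (norm x) with (sqrt (Rabs (fst x) ^ 2 + Rabs (snd x) ^ 2)).
rewrite !pow2_abs; reflexivity.
Qed.

Lemma scal_Cmult (c : R) (x : plane) : scal c x = (RtoC c * x)%C.
Proof.
apply injective_projections; unfold scal; simpl; unfold scal; simpl; unfold mult; simpl; ring.
Qed.

(** * Closure, boundary and normals of an ellipse *)

Section QuadSets.

Variables (a b : R) (A : plane -> Prop).
Hypotheses (ha : 0 < a) (hb : 0 < b) (hA : forall x, A x <-> quad a b x < 0).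

Lemma closure_quad (x : plane) : closure A x <-> quad a b x <= 0.
Proof.
split.
- intros H; apply Rnot_lt_le; intros h; apply H.
  generalize (quad_pos_near _ _ _ h); apply filter_imp; intros y hy Hy.
  apply hA in Hy; lra.
- intros H Hloc.
  (* Shrinking [x] to [(1 - t) x] lands strictly inside the ellipse, so [x] is a limit of points of
     [A]. *)
  assert (Hr := ray_eventually x (opp x) _ Hloc).
  assert (Hn := eventually_at_right (fun t => 0 < t < 1) 1 Rlt_0_1 (fun t Ht => Ht)).
  destruct (filter_ex _ (filter_and _ _ Hr Hn)) as [t [H1 [H2 H3]]].
  apply H1, hA.
  replace (quad a b (plus x (scal t (opp x)))) with ((1 - t) ^ 2 * (quad a b x + 1) - 1).
  + assert (0 < (1 - t) ^ 2 < 1) by (simpl; split; nra).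
    assert (0 <= quad a b x + 1).
    { unfold quad; assert (0 <= a * fst x ^ 2) by (apply Rmult_le_pos; [lra|apply pow2_ge_0]).
      assert (0 <= b * snd x ^ 2) by (apply Rmult_le_pos; [lra|apply pow2_ge_0]); lra. }
    nra.
  + unfold quad, plus, scal, opp; simpl; unfold plus, scal, opp; simpl; unfold mult; simpl; ring.
Qed.

Lemma exterior_quad (x : plane) : exterior A x <-> 0 < quad a b x.
Proof.
unfold exterior; rewrite closure_quad; split; [apply Rnot_le_lt|intros h h'; lra].
Qed.

Lemma boundary_quad (x : plane) : boundary A x <-> quad a b x = 0.
Proof.
unfold boundary; rewrite closure_quad; split.
- intros [h1 h2]; apply Rle_antisym; [exact h1|].
  apply Rnot_lt_le; intros h; apply h2.
  generalize (quad_neg_near _ _ _ h); apply filter_imp; intros y hy Hy; apply Hy, hA, hy.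
- intros h; split; [lra|intros Hloc].
  apply locally_singleton in Hloc; apply Hloc; rewrite hA; lra.
Qed.

Lemma quad_outward_normal (x : plane) :
  quad a b x = 0 -> exists k nu, 0 < k /\ quad_grad a b x = scal k nu /\
  outward_unit_normal A x nu.
Proof.
intros hx.
set (N := quad_grad a b x).
assert (hN : 0 < norm N).
{ apply Rnot_le_lt; intros h.
  rewrite norm_Cmod in h; assert (E : N = RtoC 0).
  { apply Cmod_eq_0, Rle_antisym; [exact h|apply Cmod_ge_0]. }
  assert (E1 : 2 * a * fst x = 0) by exact (f_equal fst E).
  assert (E2 : 2 * b * snd x = 0) by exact (f_equal snd E).
  apply Rmult_integral in E1; apply Rmult_integral in E2.
  assert (F1 : fst x = 0) by lra; assert (F2 : snd x = 0) by lra.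
  unfold quad in hx; rewrite F1, F2 in hx; lra. }
assert (HN : N = scal (norm N) (scal (/ norm N) N)).
{ rewrite scal_assoc; unfold mult; simpl; rewrite Rinv_r by lra.
  symmetry; apply (scal_one (V := prod_ModuleSpace R_Ring R_ModuleSpace R_ModuleSpace)). }
exists (norm N), (scal (/ norm N) N); split; [exact hN|split; [exact HN|]].
split; [apply boundary_quad, hx|split].
- rewrite norm_Cmod, scal_Cmult, Cmod_mult, Cmod_R, <- norm_Cmod.
  rewrite Rabs_right; [apply Rinv_l; lra|]; left; apply Rinv_0_lt_compat, hN.
- exists (quad a b), (norm N); split; [|split; [|split]].
  + apply filter_forall; intros y.
    assert (Hc : forall c : R, forall z, continuity_2d_pt (fun u v : R => c * u) (fst z) (snd z)).
    { intros c z; apply continuity_2d_pt_mult;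
      [apply continuity_2d_pt_const|apply continuity_2d_pt_id1]. }
    assert (Hc' : forall c : R, forall z, continuity_2d_pt (fun u v : R => c * v) (fst z) (snd z)).
    { intros c z; apply continuity_2d_pt_mult;
      [apply continuity_2d_pt_const|apply continuity_2d_pt_id2]. }
    simpl; unfold curried, quad; simpl; repeat split; try (auto_derive; auto; fail).
    * repeat first [apply continuity_2d_pt_minus|apply continuity_2d_pt_plus|
        apply continuity_2d_pt_mult|apply continuity_2d_pt_const|apply continuity_2d_pt_id1|
        apply continuity_2d_pt_id2].
    * apply continuity_2d_pt_ext with (2 := Hc (2 * a) y).
      intros u v; symmetry; apply is_derive_unique; auto_derive; auto; ring.
    * apply continuity_2d_pt_ext with (2 := Hc' (2 * b) y).
      intros u v; symmetry; apply is_derive_unique; auto_derive; auto; ring.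
  + apply filter_forall; exact hA.
  + exact hN.
  + rewrite <- HN; apply injective_projections.
    * apply (is_derive_unique (fun t => quad a b (t, snd x))); unfold quad; simpl.
      auto_derive; auto; ring.
    * apply (is_derive_unique (fun t => quad a b (fst x, t))); unfold quad; simpl.
      auto_derive; auto; ring.
Qed.

End QuadSets.

(** * Complex differentiation *)

Lemma caratheodory_is_derive (h k : R -> R) (t0 : R) :
  locally t0 (fun t => h t = h t0 + k t * (t - t0)) -> continuous k t0 ->
  is_derive h t0 (k t0).
Proof.
intros Hh Hk; apply is_derive_ext_loc with (fun t => h t0 + k t * (t - t0)).
- generalize Hh; apply filter_imp; intros t Ht; symmetry; exact Ht.
- apply is_derive_Reals; intros e he.
  destruct (proj1 (filterlim_locally _ _) Hk (mkposreal e he)) as [d Hd].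
  exists d; intros u Hu Hud.
  replace ((h t0 + k (t0 + u) * (t0 + u - t0) - (h t0 + k t0 * (t0 - t0))) / u - k t0)
    with (k (t0 + u) - k t0) by (field; exact Hu).
  apply Hd; unfold ball; simpl; unfold AbsRing_ball, abs, minus, plus, opp; simpl.
  replace (t0 + u + - t0) with u by ring; exact Hud.
Qed.

(** Continuity is taken by components so that the real-valued theory applies; [plane] and [C] are
    the same product type. *)
Definition ccontinuous (f : plane -> C) (x : plane) : Prop :=
  continuous (fun y => Re (f y)) x /\ continuous (fun y => Im (f y)) x.

Lemma ccontinuous_const (c : C) (x : plane) : ccontinuous (fun _ => c) x.
Proof. split; apply continuous_const. Qed.

Lemma ccontinuous_id (x : plane) : ccontinuous (fun y => y) x.
Proof. destruct x; split; [apply continuous_fst|apply continuous_snd]. Qed.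

Lemma ccontinuous_plus (f g : plane -> C) (x : plane) :
  ccontinuous f x -> ccontinuous g x -> ccontinuous (fun y => (f y + g y)%C) x.
Proof.
intros [F1 F2] [G1 G2]; split.
- exact (continuous_plus _ _ x F1 G1).
- exact (continuous_plus _ _ x F2 G2).
Qed.

Lemma ccontinuous_mult (f g : plane -> C) (x : plane) :
  ccontinuous f x -> ccontinuous g x -> ccontinuous (fun y => (f y * g y)%C) x.
Proof.
intros [F1 F2] [G1 G2]; split.
- exact (continuous_minus (V := R_NormedModule) _ _ x
    (continuous_mult _ _ x F1 G1) (continuous_mult _ _ x F2 G2)).
- exact (continuous_plus (V := R_NormedModule) _ _ x
    (continuous_mult _ _ x F1 G2) (continuous_mult _ _ x F2 G1)).
Qed.

Lemma ccontinuous_inv (f : plane -> C) (x : plane) :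
  ccontinuous f x -> f x <> RtoC 0 -> ccontinuous (fun y => (/ f y)%C) x.
Proof.
intros [F1 F2] Hx.
assert (Hn : continuous (fun y => / (Re (f y) ^ 2 + Im (f y) ^ 2)) x).
{ apply (continuous_comp (fun y => Re (f y) ^ 2 + Im (f y) ^ 2) Rinv).
  - apply continuous_ext with (fun y => Re (f y) * Re (f y) + Im (f y) * Im (f y));
      [intros y; change (Re (f y) * Re (f y) + Im (f y) * Im (f y) =
        Re (f y) ^ 2 + Im (f y) ^ 2); ring|].
    exact (continuous_plus (V := R_NormedModule) _ _ x
      (continuous_mult _ _ x F1 F1) (continuous_mult _ _ x F2 F2)).
  - apply continuous_Rinv; intros E; apply Hx, Cmod_eq_0.
    apply Rsqr_0_uniq; unfold Rsqr.
    replace (Cmod (f x) * Cmod (f x)) with (Cmod (f x) ^ 2) by ring.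
    rewrite Cmod2_alt; exact E. }
split.
- exact (continuous_mult _ _ x F1 Hn).
- exact (continuous_mult _ _ x (continuous_opp (V := R_NormedModule) _ x F2) Hn).
Qed.

(** Complex differentiability in Caratheodory's form, [k] being the slope function. *)
Definition cdiff (f : plane -> C) (x : plane) (d : C) : Prop :=
  exists k : plane -> C, ccontinuous k x /\ k x = d /\
    locally x (fun y => f y = (f x + k y * ((y : C) - (x : C)))%C).

Lemma cdiff_continuous (f : plane -> C) (x : plane) (d : C) :
  cdiff f x d -> ccontinuous f x.
Proof.
intros [k [Hk [_ Hf]]].
assert (H : ccontinuous (fun y => (f x + k y * ((y : C) + - (x : C)))%C) x).
{ apply ccontinuous_plus; [apply ccontinuous_const|apply ccontinuous_mult; [exact Hk|]].
  apply ccontinuous_plus; [apply ccontinuous_id|apply ccontinuous_const]. }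
destruct H as [H1 H2]; split.
- apply continuous_ext_loc with (2 := H1).
  generalize Hf; apply filter_imp; intros y ->; reflexivity.
- apply continuous_ext_loc with (2 := H2).
  generalize Hf; apply filter_imp; intros y ->; reflexivity.
Qed.

Lemma cdiff_const (c : C) (x : plane) : cdiff (fun _ => c) x (RtoC 0).
Proof.
exists (fun _ => RtoC 0); split; [apply ccontinuous_const|split; [reflexivity|]].
apply filter_forall; intros y; ring.
Qed.

Lemma cdiff_plus (f g : plane -> C) (x : plane) (df dg : C) :
  cdiff f x df -> cdiff g x dg -> cdiff (fun y => (f y + g y)%C) x (df + dg)%C.
Proof.
intros [k [Hk [<- Hf]]] [m [Hm [<- Hg]]].
exists (fun y => (k y + m y)%C); split; [apply ccontinuous_plus; auto|split; [reflexivity|]].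
generalize (filter_and _ _ Hf Hg); apply filter_imp; intros y [-> ->]; ring.
Qed.

Lemma cdiff_mult (f g : plane -> C) (x : plane) (df dg : C) :
  cdiff f x df -> cdiff g x dg ->
  cdiff (fun y => (f y * g y)%C) x (df * g x + f x * dg)%C.
Proof.
intros Hf' Hg'; assert (Hgc := cdiff_continuous _ _ _ Hg').
destruct Hf' as [k [Hk [<- Hf]]]; destruct Hg' as [m [Hm [<- Hg]]].
exists (fun y => (k y * g y + f x * m y)%C); split; [|split; [reflexivity|]].
- apply ccontinuous_plus; apply ccontinuous_mult; auto; apply ccontinuous_const.
- generalize (filter_and _ _ Hf Hg); apply filter_imp; intros y [H1 H2].
  rewrite H1, H2; ring.
Qed.

Lemma cdiff_inv (f : plane -> C) (x : plane) (d : C) :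
  cdiff f x d -> locally x (fun y => f y <> RtoC 0) ->
  cdiff (fun y => (/ f y)%C) x (- d / (f x * f x))%C.
Proof.
intros Hf' Hnz; assert (Hfc := cdiff_continuous _ _ _ Hf').
destruct Hf' as [k [Hk [<- Hf]]]; assert (Hx := locally_singleton _ _ Hnz).
exists (fun y => ((RtoC (-1) * k y) * / (f y * f x))%C); split; [|split].
- apply ccontinuous_mult; [apply ccontinuous_mult; [apply ccontinuous_const|exact Hk]|].
  apply ccontinuous_inv; [apply ccontinuous_mult; [exact Hfc|apply ccontinuous_const]|].
  apply Cmult_neq_0; exact Hx.
- field; exact Hx.
- generalize (filter_and _ _ Hf Hnz); apply filter_imp; intros y [H1 H2].
  assert (E : (k y * ((y : C) - (x : C)) = f y - f x)%C) by (rewrite H1; ring).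
  transitivity (/ f x + - (k y * ((y : C) - (x : C))) / (f y * f x))%C.
  + rewrite E; field; split; assumption.
  + field; split; assumption.
Qed.

(** The Cauchy-Riemann equations: on the vertical line the complex increment is [i] times a real
    one, so the slope is multiplied by [i]. *)
Lemma cdiff_partials (f : plane -> C) (x : plane) (d : C) :
  cdiff f x d ->
  is_derive (fun t => Re (f (t, snd x))) (fst x) (Re d) /\
  is_derive (fun t => Im (f (t, snd x))) (fst x) (Im d) /\
  is_derive (fun t => Re (f (fst x, t))) (snd x) (- Im d) /\
  is_derive (fun t => Im (f (fst x, t))) (snd x) (Re d).
Proof.
destruct x as [x1 x2]; intros [k [[Hk1 Hk2] [<- Hf]]]; simpl.
assert (HfX := locally_horizontal _ _ Hf); assert (HfY := locally_vertical _ _ Hf).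
simpl in HfX, HfY.
assert (Hh : forall (u : plane -> R), continuous u (x1, x2) ->
  continuous (fun t => u (t, x2)) x1).
{ intros u Hu; apply filterlim_locally; intros e.
  exact (locally_horizontal _ _ (proj1 (filterlim_locally _ _) Hu e)). }
assert (Hv : forall (u : plane -> R), continuous u (x1, x2) ->
  continuous (fun t => u (x1, t)) x2).
{ intros u Hu; apply filterlim_locally; intros e.
  exact (locally_vertical _ _ (proj1 (filterlim_locally _ _) Hu e)). }
split; [|split; [|split]].
- apply (caratheodory_is_derive _ (fun t => Re (k (t, x2)))).
  + generalize HfX; apply filter_imp; intros t ->; simpl; unfold Re, Im; ring.
  + apply (Hh _ Hk1).
- apply (caratheodory_is_derive _ (fun t => Im (k (t, x2)))).
  + generalize HfX; apply filter_imp; intros t ->; simpl; unfold Re, Im; ring.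
  + apply (Hh _ Hk2).
- apply (caratheodory_is_derive _ (fun t => - Im (k (x1, t)))).
  + generalize HfY; apply filter_imp; intros t ->; simpl; unfold Re, Im; ring.
  + apply (continuous_opp (V := R_NormedModule)), (Hv _ Hk2).
- apply (caratheodory_is_derive _ (fun t => Re (k (x1, t)))).
  + generalize HfY; apply filter_imp; intros t ->; simpl; unfold Re, Im; ring.
  + apply (Hv _ Hk1).
Qed.

(** The gradient of the real part of a holomorphic function is the conjugate of its derivative. *)
Definition holo_grad (df : plane -> C) (x : plane) : plane := (Re (df x), - Im (df x)).

(** The two pure second derivatives of the real part are [Re ddf] and [- Re ddf]. *)
Lemma holomorphic_laplacian_at (f df : plane -> C) (x : plane) (ddf : C) :
  locally x (fun y => cdiff f y (df y) /\ ccontinuous df y) -> cdiff df x ddf ->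
  laplacian_at (fun y => Re (f y)) (holo_grad df) 0 x.
Proof.
intros Hf Hdf; split; [|split; [|split]].
- generalize Hf; apply filter_imp; intros y [Hy _]; split; apply (cdiff_partials _ _ _ Hy).
- apply (cdiff_continuous f x (df x)); exact (proj1 (locally_singleton _ _ Hf)).
- generalize Hf; apply filter_imp; intros y [_ [H1 H2]]; split; [exact H1|].
  apply (continuous_opp (V := R_NormedModule)), H2.
- exists (Re ddf), (- Re ddf); split; [|split; [|ring]].
  + apply (cdiff_partials _ _ _ Hdf).
  + apply (is_derive_opp (V := R_NormedModule)), (cdiff_partials _ _ _ Hdf).
Qed.

(** * Separated solutions in elliptic coordinates *)

(** The complex exponential of [r + i t]. *)
Definition pol (r t : R) : C := (exp r * cos t, exp r * sin t).

Lemma pol_mult (r t s u : R) : (pol r t * pol s u)%C = pol (r + s) (t + u).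
Proof.
unfold pol; apply injective_projections; simpl; rewrite exp_plus;
[rewrite cos_plus|rewrite sin_plus]; ring.
Qed.

Lemma pol_0 : pol 0 0 = RtoC 1.
Proof.
unfold pol; rewrite exp_0, cos_0, sin_0; apply injective_projections; simpl; ring.
Qed.

Lemma Cmod_pol (r t : R) : Cmod (pol r t) = exp r.
Proof.
unfold Cmod, pol; simpl fst; simpl snd.
replace ((exp r * cos t) ^ 2 + (exp r * sin t) ^ 2) with (exp r ^ 2 * (cos t ^ 2 + sin t ^ 2))
  by ring.
rewrite cos2_sin2, Rmult_1_r; apply sqrt_pow2; left; apply exp_pos.
Qed.

Lemma pol_neq_0 (r t : R) : pol r t <> RtoC 0.
Proof. apply Cmod_gt_0; rewrite Cmod_pol; apply exp_pos. Qed.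

Lemma pol_inv (r t : R) : (/ pol r t)%C = pol (- r) (- t).
Proof.
assert (H : (pol r t * pol (- r) (- t) = 1)%C) by (rewrite pol_mult, !Rplus_opp_r; apply pol_0).
transitivity (/ pol r t * (pol r t * pol (- r) (- t)))%C.
- rewrite H; ring.
- field; apply pol_neq_0.
Qed.

Lemma pol_pow (r t : R) (n : nat) : (pol r t ^ n)%C = pol (INR n * r) (INR n * t).
Proof.
induction n as [|n IH].
- simpl; rewrite !Rmult_0_l; symmetry; apply pol_0.
- rewrite Cpow_S, IH, pol_mult, S_INR; f_equal; ring.
Qed.

(** The complement of the focal segment, on which [jinv] is holomorphic. Any real [eta] is allowed,
    so no angle has to be reduced modulo [2 * PI]. *)
Definition off_segment (l : R) (x : plane) : Prop := exists xi eta, 0 < xi /\ x = elliptic l xi eta.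

(** * The inverse Joukowski map and its derivative *)

Definition joukowski (l : R) (q : C) : C := (RtoC (l / 2) * (q + / q))%C.

(** The inverse Joukowski map [exp (- (xi + i eta))], which is characterized algebraically. *)
Definition jinv (l : R) (x : plane) : C :=
  epsilon (inhabits (RtoC 0))
    (fun q : C => q <> RtoC 0 /\ Cmod q < 1 /\ (x : C) = joukowski l q).

Lemma Cmod_lt_1_neq (q p : C) : Cmod q < 1 -> Cmod p < 1 -> (q * p <> 1)%C.
Proof.
intros hq hp E.
assert (H : Cmod q * Cmod p = 1) by (rewrite <- Cmod_mult, E; apply Cmod_1).
assert (H1 := Cmod_ge_0 q); assert (H2 := Cmod_ge_0 p).
assert (Cmod q * Cmod p <= Cmod q * 1) by (apply Rmult_le_compat_l; lra); lra.
Qed.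

(** The source of all facts about [jinv]. In the open unit disc [q * p - 1] is nonzero, so the
    identity gives injectivity, a Lipschitz bound and the difference quotient of the inverse,
    without any branch of a square root or logarithm. *)
Lemma joukowski_difference (l : R) (q p : C) :
  l <> 0 -> q <> RtoC 0 -> p <> RtoC 0 ->
  ((q - p) * (q * p - 1) = RtoC (2 / l) * (joukowski l q - joukowski l p) * (q * p))%C.
Proof.
intros hl hq hp; unfold joukowski.
assert (E : (RtoC (2 / l) * RtoC (l / 2) = 1)%C).
{ rewrite <- RtoC_mult; f_equal; field; exact hl. }
transitivity (RtoC (2 / l) * RtoC (l / 2) * ((q + / q) - (p + / p)) * (q * p))%C; [|ring].
rewrite E; field; split; assumption.
Qed.

Lemma jinv_spec (l : R) (x : plane) :
  off_segment l x -> jinv l x <> RtoC 0 /\ Cmod (jinv l x) < 1 /\ (x : C) = joukowski l (jinv l x).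
Proof.
intros [xi [eta [hx ->]]].
apply (epsilon_spec (inhabits (RtoC 0))
  (fun q : C => q <> RtoC 0 /\ Cmod q < 1 /\ (elliptic l xi eta : C) = joukowski l q)).
exists (pol (- xi) (- eta)); split; [apply pol_neq_0|split].
- rewrite Cmod_pol, <- exp_0; apply exp_increasing; lra.
- unfold joukowski; rewrite pol_inv, !Ropp_involutive; unfold elliptic, pol, cosh, sinh.
  rewrite cos_neg, sin_neg; apply injective_projections; simpl; field.
Qed.

Lemma jinv_unique (l : R) (x : plane) (q : C) :
  0 < l -> q <> RtoC 0 -> Cmod q < 1 -> off_segment l x -> (x : C) = joukowski l q ->
  jinv l x = q.
Proof.
intros hl hq hq1 hx Hq; destruct (jinv_spec l x hx) as [h1 [h2 h3]].
assert (E := joukowski_difference l (jinv l x) q (Rgt_not_eq _ _ hl) h1 hq).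
rewrite <- h3, <- Hq in E.
assert (E0 : ((jinv l x - q) * (jinv l x * q - 1) = 0)%C) by (rewrite E; ring).
assert (hne : (jinv l x * q - 1 <> 0)%C).
{ intros H; apply (Cmod_lt_1_neq (jinv l x) q h2 hq1).
  replace (jinv l x * q)%C with ((jinv l x * q - 1) + 1)%C by ring; rewrite H; ring. }
assert (E1 : (jinv l x - q = 0)%C).
{ transitivity (((jinv l x - q) * (jinv l x * q - 1)) / (jinv l x * q - 1))%C.
  - field; exact hne.
  - rewrite E0; field; exact hne. }
replace (jinv l x) with ((jinv l x - q) + q)%C by ring; rewrite E1; ring.
Qed.

Lemma jinv_elliptic (l xi eta : R) :
  0 < l -> 0 < xi -> jinv l (elliptic l xi eta) = pol (- xi) (- eta).
Proof.
intros hl hx; apply jinv_unique; auto.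
- apply pol_neq_0.
- rewrite Cmod_pol, <- exp_0; apply exp_increasing; lra.
- exists xi, eta; auto.
- unfold joukowski; rewrite pol_inv, !Ropp_involutive; unfold elliptic, pol, cosh, sinh.
  rewrite cos_neg, sin_neg; apply injective_projections; simpl; field.
Qed.

Lemma off_segment_quad (l xi0 : R) (x : plane) :
  0 < l -> 0 < xi0 -> 0 <= quad (ell_a l xi0) (ell_b l xi0) x -> off_segment l x.
Proof.
intros hl h0; destruct (elliptic_surjective l x hl) as [xi [eta [h1 [_ ->]]]]; intros H.
exists xi, eta; split; [|reflexivity].
destruct (quad_elliptic_sign l xi0 xi eta hl h0 h1) as [H1 _].
apply Rnot_le_lt; intros h.
assert (H2 := proj2 H1 (Rle_lt_trans _ _ _ h h0)); lra.
Qed.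

Lemma off_segment_open (l : R) (x : plane) :
  0 < l -> off_segment l x -> locally x (off_segment l).
Proof.
intros hl [xi [eta [hx ->]]].
assert (H : 0 < quad (ell_a l (xi / 2)) (ell_b l (xi / 2)) (elliptic l xi eta))
  by (apply quad_elliptic_sign; lra).
generalize (quad_pos_near _ _ _ H); apply filter_imp; intros y hy.
apply off_segment_quad with (xi / 2); lra.
Qed.

(** Since [jinv l y] has modulus below 1, [jinv l y * jinv l x - 1] has modulus at least
    [1 - Cmod (jinv l x)]. The constant thus depends on [x] alone, which gives continuity at [x]. *)
Lemma jinv_lipschitz (l : R) (x y : plane) :
  0 < l -> off_segment l x -> off_segment l y ->
  Cmod (jinv l y - jinv l x) <=
  2 / l / (1 - Cmod (jinv l x)) * (Rabs (fst y - fst x) + Rabs (snd y - snd x)).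
Proof.
intros hl hx hy.
destruct (jinv_spec l x hx) as [x1 [x2 x3]]; destruct (jinv_spec l y hy) as [y1 [y2 y3]].
assert (E := joukowski_difference l _ _ (Rgt_not_eq _ _ hl) y1 x1).
rewrite <- x3, <- y3 in E; apply (f_equal Cmod) in E; rewrite !Cmod_mult in E.
set (qx := Cmod (jinv l x)) in *; set (qy := Cmod (jinv l y)) in *.
assert (px := Cmod_ge_0 (jinv l x)); assert (py := Cmod_ge_0 (jinv l y)).
fold qx in px; fold qy in py.
assert (hl2 : 0 < 2 / l) by (apply Rdiv_lt_0_compat; lra).
rewrite Cmod_R, (Rabs_right (2 / l)) in E by lra.
set (d := Cmod (jinv l y - jinv l x)) in *.
assert (pd : 0 <= d) by apply Cmod_ge_0.
set (D := Rabs (fst y - fst x) + Rabs (snd y - snd x)).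
assert (hD : Cmod ((y : C) - (x : C)) <= D).
{ replace ((y : C) - (x : C))%C
    with (RtoC (fst y - fst x) + RtoC (snd y - snd x) * Ci)%C
    by (apply injective_projections; simpl; ring).
  eapply Rle_trans; [apply Cmod_triangle|].
  rewrite Cmod_mult, Cmod_Ci, !Cmod_R, Rmult_1_r; apply Rle_refl. }
assert (hqq : qy * qx <= qx).
{ replace qx with (1 * qx) at 2 by ring; apply Rmult_le_compat_r; lra. }
assert (pqq : 0 <= qy * qx) by (apply Rmult_le_pos; assumption).
assert (hm : 1 - qx <= Cmod (jinv l y * jinv l x - 1)).
{ assert (H := Cmod_triangle (jinv l y * jinv l x)%C (- (jinv l y * jinv l x - 1))%C).
  replace (jinv l y * jinv l x + - (jinv l y * jinv l x - 1))%C with (RtoC 1) in H by ring.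
  rewrite Cmod_1, Cmod_opp, Cmod_mult in H; fold qx qy in H; lra. }
assert (H : d * (1 - qx) <= 2 / l * D).
{ apply Rle_trans with (d * Cmod (jinv l y * jinv l x - 1)).
  - apply Rmult_le_compat_l; assumption.
  - rewrite E, Rmult_assoc; apply Rmult_le_compat_l; [lra|].
    apply Rle_trans with (Cmod ((y : C) - (x : C)) * 1).
    + apply Rmult_le_compat_l; [apply Cmod_ge_0|lra].
    + lra. }
apply Rmult_le_reg_r with (1 - qx); [lra|].
replace (2 / l / (1 - qx) * D * (1 - qx)) with (2 / l * D) by (field; lra); exact H.
Qed.

Lemma jinv_continuous (l : R) (x : plane) :
  0 < l -> off_segment l x -> ccontinuous (jinv l) x.
Proof.
intros hl hx; destruct (jinv_spec l x hx) as [_ [hq _]].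
set (K := 2 / l / (1 - Cmod (jinv l x))).
assert (hK : 0 < K) by (repeat apply Rdiv_lt_0_compat; lra).
assert (Hn : forall e : posreal, locally x (fun y => Cmod (jinv l y - jinv l x) < e)).
{ intros e; assert (hd : 0 < e / (4 * K)).
  { apply Rdiv_lt_0_compat; [apply cond_pos|lra]. }
  assert (Hb : locally x (fun y : plane =>
    Rabs (fst y - fst x) < e / (4 * K) /\ Rabs (snd y - snd x) < e / (4 * K))).
  { apply near_plane; exists (e / (4 * K)); split; auto. }
  generalize (filter_and _ _ (off_segment_open l x hl hx) Hb); apply filter_imp.
  intros y [hy [H1 H2]].
  apply Rle_lt_trans with (1 := jinv_lipschitz l x y hl hx hy); fold K.
  apply Rle_lt_trans with (K * (e / (4 * K) + e / (4 * K))).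
  - apply Rmult_le_compat_l; lra.
  - replace (K * (e / (4 * K) + e / (4 * K))) with (e / 2) by (field; lra).
    assert (H := cond_pos e); lra. }
split; apply filterlim_locally; intros e; generalize (Hn e); apply filter_imp; intros y Hy;
(eapply Rle_lt_trans; [|exact Hy]).
- exact (re_le_Cmod (jinv l y - jinv l x)).
- assert (H := Rmax_Cmod (jinv l y - jinv l x)%C).
  eapply Rle_trans; [|exact H]; apply Rmax_r.
Qed.

Lemma quad_minus_1_neq_0 (q : C) : Cmod q < 1 -> (q * q - 1 <> 0)%C.
Proof.
intros h E; apply (Cmod_lt_1_neq q q h h).
replace (q * q)%C with (q * q - 1 + 1)%C by ring; rewrite E; ring.
Qed.

(** [log_slope] is the logarithmic derivative of [jinv]. *)
Definition log_slope (l : R) (x : plane) : C :=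
  (RtoC (2 / l) * jinv l x * / (jinv l x * jinv l x + RtoC (-1)))%C.

Lemma jinv_cdiff (l : R) (x : plane) :
  0 < l -> off_segment l x -> cdiff (jinv l) x (jinv l x * log_slope l x)%C.
Proof.
intros hl hx; assert (Hc := jinv_continuous l x hl hx).
destruct (jinv_spec l x hx) as [x1 [x2 x3]].
assert (hne := quad_minus_1_neq_0 _ x2).
(* The slope [(jinv l y - jinv l x) / (y - x)] as [joukowski_difference] expresses it; unlike the
   quotient it is defined and continuous at [y = x]. *)
exists (fun y => (RtoC (2 / l) * (jinv l y * jinv l x) * / (jinv l y * jinv l x + RtoC (-1)))%C).
assert (H2 : ccontinuous (fun y => (jinv l y * jinv l x)%C) x)
  by (apply ccontinuous_mult; [exact Hc|apply ccontinuous_const]).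
split; [|split].
- apply ccontinuous_mult.
  + apply ccontinuous_mult; [apply ccontinuous_const|exact H2].
  + apply ccontinuous_inv; [apply ccontinuous_plus; [exact H2|apply ccontinuous_const]|].
    intros E; apply hne; rewrite <- E; ring.
- unfold log_slope; ring.
- generalize (off_segment_open l x hl hx); apply filter_imp; intros y hy.
  destruct (jinv_spec l y hy) as [y1 [y2 y3]].
  assert (hm : (jinv l y * jinv l x + RtoC (-1) <> 0)%C).
  { intros E; apply (Cmod_lt_1_neq _ _ y2 x2).
    replace (jinv l y * jinv l x)%C with (jinv l y * jinv l x + RtoC (-1) + 1)%C by ring.
    rewrite E; ring. }
  assert (E := joukowski_difference l _ _ (Rgt_not_eq _ _ hl) y1 x1).
  rewrite <- x3, <- y3 in E.
  transitivity (jinv l x + (jinv l y - jinv l x) * (jinv l y * jinv l x - 1)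
     * / (jinv l y * jinv l x + RtoC (-1)))%C.
  + field; exact hm.
  + rewrite E; field; exact hm.
Qed.

Lemma log_slope_ex_cdiff (l : R) (x : plane) :
  0 < l -> off_segment l x -> exists d, cdiff (log_slope l) x d.
Proof.
intros hl hx; assert (Hq := jinv_cdiff l x hl hx).
eexists; unfold log_slope; apply cdiff_mult.
- apply cdiff_mult; [apply cdiff_const|exact Hq].
- apply cdiff_inv.
  + apply cdiff_plus; [apply cdiff_mult; exact Hq|apply cdiff_const].
  + generalize (off_segment_open l x hl hx); apply filter_imp; intros y hy.
    destruct (jinv_spec l y hy) as [_ [y2 _]].
    intros E; apply (quad_minus_1_neq_0 _ y2); rewrite <- E; ring.
Qed.

Lemma jinv_pow_cdiff (l : R) (n : nat) (x : plane) :
  0 < l -> off_segment l x ->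
  cdiff (fun y => jinv l y ^ n)%C x (RtoC (INR n) * log_slope l x * jinv l x ^ n)%C.
Proof.
intros hl hx; assert (Hq := jinv_cdiff l x hl hx); induction n as [|n IH].
- replace (RtoC (INR 0) * log_slope l x * jinv l x ^ 0)%C with (RtoC 0)
    by (change (INR 0) with 0; ring).
  exact (cdiff_const (RtoC 1) x).
- assert (H := cdiff_mult _ _ _ _ _ Hq IH).
  replace (RtoC (INR (S n)) * log_slope l x * jinv l x ^ S n)%C with
    (jinv l x * log_slope l x * jinv l x ^ n +
     jinv l x * (RtoC (INR n) * log_slope l x * jinv l x ^ n))%C; [exact H|].
  rewrite S_INR, RtoC_plus, Cpow_S; ring.
Qed.

Lemma jinv_pow_inv_cdiff (l : R) (n : nat) (x : plane) :
  0 < l -> off_segment l x ->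
  cdiff (fun y => / jinv l y ^ n)%C x (- (RtoC (INR n) * log_slope l x * / jinv l x ^ n))%C.
Proof.
intros hl hx; assert (H := cdiff_inv _ _ _ (jinv_pow_cdiff l n x hl hx)).
destruct (jinv_spec l x hx) as [x1 _].
assert (hp := Cpow_nz _ n x1).
replace (- (RtoC (INR n) * log_slope l x * / jinv l x ^ n))%C with
  (- (RtoC (INR n) * log_slope l x * jinv l x ^ n) / (jinv l x ^ n * jinv l x ^ n))%C
  by (field; exact hp).
apply H; generalize (off_segment_open l x hl hx); apply filter_imp; intros y hy.
apply Cpow_nz, (jinv_spec l y hy).
Qed.

(** * Modes, their normal derivatives and their decay *)

Definition cmode (l : R) (n : nat) (c d : C) (x : plane) : C :=
  (c * / jinv l x ^ n + d * jinv l x ^ n)%C.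

(** The derivative of [cmode]: up to the factor [n * log_slope] it is again a mode, with the
    coefficient of the negative power negated. *)
Definition dcmode (l : R) (n : nat) (c d : C) (x : plane) : C :=
  (RtoC (INR n) * log_slope l x * cmode l n (- c) d x)%C.

Lemma cmode_cdiff (l : R) (n : nat) (c d : C) (x : plane) :
  0 < l -> off_segment l x -> cdiff (cmode l n c d) x (dcmode l n c d x).
Proof.
intros hl hx.
assert (H := cdiff_plus _ _ _ _ _
  (cdiff_mult _ _ _ _ _ (cdiff_const c x) (jinv_pow_inv_cdiff l n x hl hx))
  (cdiff_mult _ _ _ _ _ (cdiff_const d x) (jinv_pow_cdiff l n x hl hx))).
match type of H with cdiff _ _ ?D => replace (dcmode l n c d x) with D; [exact H|] end.
unfold dcmode, cmode; ring.
Qed.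

Lemma dcmode_ex_cdiff (l : R) (n : nat) (c d : C) (x : plane) :
  0 < l -> off_segment l x -> exists e, cdiff (dcmode l n c d) x e.
Proof.
intros hl hx; destruct (log_slope_ex_cdiff l x hl hx) as [s Hs].
eexists; unfold dcmode; apply cdiff_mult; [|apply cmode_cdiff; assumption].
apply cdiff_mult; [apply cdiff_const|exact Hs].
Qed.

(** In elliptic coordinates this is
    [(alpha exp (n xi) + beta exp (- n xi)) (Re kappa cos (n eta) - Im kappa sin (n eta))]. *)
Definition mode (l : R) (n : nat) (kappa : C) (alpha beta : R) (x : plane) : R :=
  Re (cmode l n (kappa * RtoC alpha) (Cconj kappa * RtoC beta) x).

Definition mode_grad (l : R) (n : nat) (kappa : C) (alpha beta : R) : plane -> plane :=
  holo_grad (dcmode l n (kappa * RtoC alpha) (Cconj kappa * RtoC beta)).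

Lemma mode_laplacian_at (l : R) (n : nat) (kappa : C) (alpha beta : R) (x : plane) :
  0 < l -> off_segment l x ->
  laplacian_at (mode l n kappa alpha beta) (mode_grad l n kappa alpha beta) 0 x.
Proof.
intros hl hx; unfold mode, mode_grad.
destruct (dcmode_ex_cdiff l n (kappa * RtoC alpha) (Cconj kappa * RtoC beta) x hl hx) as [e He].
apply holomorphic_laplacian_at with (2 := He).
generalize (off_segment_open l x hl hx); apply filter_imp; intros y hy; split.
- apply cmode_cdiff; assumption.
- destruct (dcmode_ex_cdiff l n (kappa * RtoC alpha) (Cconj kappa * RtoC beta) y hl hy) as [d Hd].
  apply cdiff_continuous with (1 := Hd).
Qed.

(** The powers [q ^ (- n)] and [q ^ n] have opposite arguments; conjugating [kappa] in the second
    coefficient gives both terms the same angular factor. *)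
Lemma mode_elliptic (l : R) (n : nat) (kappa : C) (alpha beta xi eta : R) :
  0 < l -> 0 < xi ->
  mode l n kappa alpha beta (elliptic l xi eta) =
  (alpha * exp (INR n * xi) + beta * exp (- (INR n * xi))) *
  (Re kappa * cos (INR n * eta) - Im kappa * sin (INR n * eta)).
Proof.
intros hl hx; unfold mode, cmode; rewrite jinv_elliptic, pol_pow, pol_inv by assumption.
replace (- (INR n * - xi)) with (INR n * xi) by ring.
replace (- (INR n * - eta)) with (INR n * eta) by ring.
replace (INR n * - xi) with (- (INR n * xi)) by ring.
replace (INR n * - eta) with (- (INR n * eta)) by ring.
unfold pol; rewrite cos_neg, sin_neg; destruct kappa as [k1 k2]; simpl; ring.
Qed.

(** The factor [m] does not depend on [alpha] and [beta], so every flux condition on an ellipse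
    reduces to one linear equation between coefficients. *)
Lemma mode_normal_derivative (l : R) (n : nat) (kappa : C) (xi0 k : R) (x nu : plane) :
  0 < l -> 0 < xi0 -> 0 < k -> quad (ell_a l xi0) (ell_b l xi0) x = 0 ->
  quad_grad (ell_a l xi0) (ell_b l xi0) x = scal k nu ->
  exists m, forall alpha beta, dot (mode_grad l n kappa alpha beta x) nu =
    m * (alpha * exp (INR n * xi0) - beta * exp (- (INR n * xi0))).
Proof.
intros hl h0 hk hx Hnu.
destruct (elliptic_surjective l x hl) as [xi [eta [h1 [h2 Hx]]]].
assert (E : xi = xi0) by (rewrite Hx in hx; apply quad_elliptic_sign in hx; auto).
subst xi.
assert (hc := cosh_pos xi0); assert (hs := sinh_pos xi0 h0).
set (q := jinv l x).
assert (Hq : q = pol (- xi0) (- eta)) by (unfold q; rewrite Hx; apply jinv_elliptic; assumption).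
assert (hq0 : q <> RtoC 0) by (rewrite Hq; apply pol_neq_0).
assert (hq1 : Cmod q < 1).
{ rewrite Hq, Cmod_pol, <- exp_0; apply exp_increasing; lra. }
assert (hne := quad_minus_1_neq_0 _ hq1).
set (m := 2 / (l * l * cosh xi0 * sinh xi0) / k).
assert (hlc : l * cosh xi0 <> 0) by (apply Rmult_integral_contrapositive_currified; lra).
assert (hls : l * sinh xi0 <> 0) by (apply Rmult_integral_contrapositive_currified; lra).
assert (N1 : 2 * ell_a l xi0 * fst x = k * fst nu) by exact (f_equal fst Hnu).
assert (N2 : 2 * ell_b l xi0 * snd x = k * snd nu) by exact (f_equal snd Hnu).
(* The normal is proportional to the derivative of [elliptic] in [xi], which is
   [(l / 2) (1 / q - q)] as a complex number. *)
assert (Hn : (nu : C) = (RtoC m * (RtoC (l / 2) * (/ q - q)))%C).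
{ rewrite Hq, pol_inv, !Ropp_involutive.
  rewrite Hx in N1, N2; unfold elliptic in N1, N2; simpl fst in N1; simpl snd in N2.
  apply injective_projections.
  - apply Rmult_eq_reg_l with k; [|lra]; rewrite <- N1; unfold m, ell_a, pol, sinh.
    unfold sinh in hs, hls; rewrite cos_neg, sin_neg; simpl; field; repeat split; lra.
  - apply Rmult_eq_reg_l with k; [|lra]; rewrite <- N2; unfold m, ell_b, pol, cosh.
    unfold cosh in hc, hlc; rewrite cos_neg, sin_neg; simpl; field; repeat split; lra. }
exists (m * INR n * (Re kappa * cos (INR n * eta) - Im kappa * sin (INR n * eta))).
intros alpha beta.
(* The gradient is the conjugate of the derivative, so its dot product with [nu] is the real part of
   the derivative times [nu]. There [log_slope] meets [(l / 2) (1 / q - q)], their product is -1,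
   and the negated coefficient moves from [alpha] to [beta]. *)
assert (Hdot : dot (mode_grad l n kappa alpha beta x) nu =
  m * INR n * mode l n kappa alpha (- beta) x).
{ transitivity (Re (dcmode l n (kappa * RtoC alpha) (Cconj kappa * RtoC beta) x * (nu : C))%C).
  - unfold dot, mode_grad, holo_grad, Re, Im; simpl; ring.
  - transitivity (Re (RtoC (m * INR n) *
      cmode l n (kappa * RtoC alpha) (Cconj kappa * RtoC (- beta)) x)%C).
    + f_equal; rewrite Hn; unfold dcmode, log_slope, cmode; fold q.
      assert (E : (RtoC (2 / l) * RtoC (l / 2) = 1)%C).
      { rewrite <- RtoC_mult; f_equal; field; lra. }
      assert (hqn := Cpow_nz _ n hq0).
      assert (hne' : (q * q + RtoC (-1) <> 0)%C).
      { intros H; apply hne; rewrite <- H; ring. }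
      transitivity (RtoC (INR n) * RtoC m * (RtoC (2 / l) * RtoC (l / 2)) *
        (q * (/ q - q) * / (q * q + RtoC (-1))) *
        (- (kappa * RtoC alpha) * / q ^ n + Cconj kappa * RtoC beta * q ^ n))%C; [ring|].
      rewrite E, RtoC_mult, RtoC_opp.
      replace (q * (/ q - q) * / (q * q + RtoC (-1)))%C with (- RtoC 1)%C.
      * ring.
      * field; split; assumption.
    + unfold mode; destruct (cmode l n (kappa * RtoC alpha) (Cconj kappa * RtoC (- beta)) x).
      simpl; ring. }
rewrite Hdot, Hx, mode_elliptic by assumption; ring.
Qed.

(** The product of [q] with its Joukowski value is [(l / 2) (q ^ 2 + 1)], of modulus at most [l] in
    the unit disc. *)
Lemma jinv_decay (l : R) (x : plane) :
  0 < l -> off_segment l x -> Cmod (jinv l x) * norm x <= l.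
Proof.
intros hl hx; destruct (jinv_spec l x hx) as [x1 [x2 x3]].
rewrite norm_Cmod.
replace (Cmod (jinv l x) * Cmod x) with (Cmod (RtoC (l / 2) * (jinv l x * jinv l x + 1))).
- rewrite Cmod_mult, Cmod_R, Rabs_right by lra.
  assert (H := Cmod_triangle (jinv l x * jinv l x)%C (RtoC 1)).
  rewrite Cmod_1, Cmod_mult in H.
  assert (h := Cmod_ge_0 (jinv l x)).
  assert (Cmod (jinv l x) * Cmod (jinv l x) <= 1 * 1) by (apply Rmult_le_compat; lra).
  apply Rle_trans with (l / 2 * 2); [apply Rmult_le_compat_l; lra|lra].
- rewrite <- Cmod_mult; f_equal.
  transitivity (jinv l x * joukowski l (jinv l x))%C; [unfold joukowski; field; exact x1|].
  rewrite <- x3; reflexivity.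
Qed.

(** The difference is a multiple of [q ^ n], bounded by [q] in modulus because [n] is at least 1.
    The condition at infinity therefore prescribes [alpha] and leaves [beta] free. *)
Lemma mode_difference_decay (l : R) (n : nat) (kappa : C) (alpha beta beta' : R) (x : plane) :
  0 < l -> (1 <= n)%nat -> off_segment l x -> 0 < norm x ->
  Rabs (mode l n kappa alpha beta x - mode l n kappa alpha beta' x) <=
  Cmod kappa * Rabs (beta - beta') * l / norm x.
Proof.
intros hl hn hx hx0.
destruct (jinv_spec l x hx) as [x1 [x2 x3]]; assert (h := Cmod_ge_0 (jinv l x)).
replace (mode l n kappa alpha beta x - mode l n kappa alpha beta' x) with
  (Re (Cconj kappa * RtoC (beta - beta') * jinv l x ^ n)%C).
- eapply Rle_trans; [apply re_le_Cmod|].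
  rewrite !Cmod_mult, Cmod_conj, Cmod_R, Cmod_pow.
  replace (Cmod kappa * Rabs (beta - beta') * l / norm x)
    with (Cmod kappa * Rabs (beta - beta') * (l / norm x)) by (field; lra).
  apply Rmult_le_compat_l; [apply Rmult_le_pos; [apply Cmod_ge_0|apply Rabs_pos]|].
  apply Rle_trans with (Cmod (jinv l x)).
  + destruct n as [|n]; [lia|]; simpl.
    rewrite <- (Rmult_1_r (Cmod (jinv l x))) at 3; apply Rmult_le_compat_l; [exact h|].
    rewrite <- (pow1 n); apply pow_incr; lra.
  + apply Rmult_le_reg_r with (norm x); [exact hx0|].
    replace (l / norm x * norm x) with l by (field; lra).
    apply jinv_decay; assumption.
- unfold mode, cmode; rewrite RtoC_minus.
  transitivity (Re ((kappa * RtoC alpha * / jinv l x ^ n + Cconj kappa * RtoC beta * jinv l x ^ n)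
    - (kappa * RtoC alpha * / jinv l x ^ n + Cconj kappa * RtoC beta' * jinv l x ^ n))%C).
  + f_equal; ring.
  + reflexivity.
Qed.

(** * Uniqueness and the explicit solution *)

Lemma laplacian_at_grad_unique (w w' : plane -> R) (g g' : plane -> plane) (s s' : R)
    (x : plane) :
  laplacian_at w g s x -> laplacian_at w' g' s' x -> locally x (fun y => w y = w' y) ->
  g x = g' x.
Proof.
intros [H _] [H' _] He; destruct (locally_singleton _ _ H) as [H1 H2].
destruct (locally_singleton _ _ H') as [H1' H2'].
apply injective_projections.
- rewrite <- (is_derive_unique _ _ _ H1), <- (is_derive_unique _ _ _ H1').
  apply Derive_ext_loc; generalize (locally_horizontal _ _ He); apply filter_imp; auto.
- rewrite <- (is_derive_unique _ _ _ H2), <- (is_derive_unique _ _ _ H2').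
  apply Derive_ext_loc; generalize (locally_vertical _ _ He); apply filter_imp; auto.
Qed.

(** [w], with gradient [g], is harmonic off the ellipses [D] and [Omega], has zero flux through
    the former and a flux jumping by [J] across the latter. *)
Definition transmission (D Omega : plane -> Prop) (a b a' b' : R)
    (w : plane -> R) (g : plane -> plane) (J : plane -> plane -> R) : Prop :=
  (forall x, 0 < quad a b x -> quad a' b' x <> 0 -> laplacian_at w g 0 x) /\
  (forall x nu k, quad a b x = 0 -> 0 < k -> quad_grad a b x = scal k nu ->
     outward_unit_normal D x nu ->
     exists v, is_trace (fun y => 0 < quad a b y) w x v /\
     filterlim (fun t => dot (g (plus x (scal t nu))) nu) (at_right 0) (locally 0)) /\
  (forall x nu k, quad a' b' x = 0 -> 0 < k -> quad_grad a' b' x = scal k nu ->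
     outward_unit_normal Omega x nu ->
     exists v dp dm, is_trace (fun y => 0 < quad a' b' y) w x v /\
     is_trace (fun y => quad a' b' y < 0 /\ 0 < quad a b y) w x v /\
     filterlim (fun t => dot (g (plus x (scal t nu))) nu) (at_right 0) (locally dp) /\
     filterlim (fun t => dot (g (plus x (scal t (opp nu)))) nu) (at_right 0) (locally dm) /\
     dp - dm = J x nu).

Lemma abs_le_norm (x : plane) : Rabs (fst x) <= norm x /\ Rabs (snd x) <= norm x.
Proof.
rewrite norm_Cmod; assert (H := Rmax_Cmod x); split.
- eapply Rle_trans; [apply Rmax_l|exact H].
- eapply Rle_trans; [apply Rmax_r|exact H].
Qed.

(** The jumps [J] cancel in the difference, to which the maximum principle for equal fluxes on both
    sides then applies. *)
Lemma transmission_comparison (D Omega : plane -> Prop) (a b a' b' C r : R)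
    (w1 w2 : plane -> R) (g1 g2 : plane -> plane) (J : plane -> plane -> R) :
  0 < a' < a -> 0 < b' < b ->
  (forall x, D x <-> quad a b x < 0) -> (forall x, Omega x <-> quad a' b' x < 0) ->
  transmission D Omega a b a' b' w1 g1 J -> transmission D Omega a b a' b' w2 g2 J ->
  (forall x, 0 < quad a b x -> quad a' b' x <> 0 -> 0 < norm x -> r <= norm x ->
     Rabs (w1 x - w2 x) <= C / norm x) ->
  forall x, 0 < quad a b x -> quad a' b' x <> 0 -> w1 x <= w2 x.
Proof.
intros ha hb hD hO [L1 [I1 O1]] [L2 [I2 O2]] Hdec.
assert (H : forall x, 0 < quad a b x -> quad a' b' x <> 0 -> w1 x + (-1) * w2 x <= 0);
  [|intros x H1 H2; specialize (H x H1 H2); lra].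
apply (transmission_maximum_principle a b a' b' _
  (fun y => plus (g1 y) (scal (-1) (g2 y)))); auto.
- intros x H1 H2; replace 0 with (0 + -1 * 0) by ring.
  apply laplacian_at_combine; auto.
- intros x hx; destruct (quad_outward_normal a b D) with (x := x) as [k [nu [hk [Hk Hn]]]];
    auto; try lra.
  destruct (I1 x nu k) as [v1 [T1 F1]]; auto; destruct (I2 x nu k) as [v2 [T2 F2]]; auto.
  exists (v1 + -1 * v2), nu, k; repeat split; auto.
  + apply is_trace_combine; auto.
  + assert (Hf := filterlim_ray_combine (-1) g1 g2 x nu nu 0 0 F1 F2).
    rewrite Rmult_0_r, Rplus_0_r in Hf; exact Hf.
- intros x hx; destruct (quad_outward_normal a' b' Omega) with (x := x)
    as [k [nu [hk [Hk Hn]]]]; auto; try lra.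
  destruct (O1 x nu k) as [v1 [p1 [m1 [T1 [S1 [F1 [G1 J1]]]]]]]; auto.
  destruct (O2 x nu k) as [v2 [p2 [m2 [T2 [S2 [F2 [G2 J2]]]]]]]; auto.
  exists (v1 + -1 * v2), (p1 + -1 * p2), nu, k; split; [exact hk|split; [exact Hk|]].
  split; [|split; [|split]].
  + apply is_trace_combine; auto.
  + apply is_trace_combine; auto.
  + apply filterlim_ray_combine; auto.
  + replace (p1 + -1 * p2) with (m1 + -1 * m2) by lra; apply filterlim_ray_combine; auto.
(* Beyond [Rabs C / e] the bound [C / norm x] is at most [e]; the added 1 keeps the norm
   positive. *)
- intros e he; exists (Rmax r (Rabs C / e + 1)); intros x H1 H2 Hr.
  destruct (abs_le_norm x) as [N1 N2].
  assert (A1 := Rmax_l r (Rabs C / e + 1)); assert (A2 := Rmax_r r (Rabs C / e + 1)).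
  assert (hC : 0 <= Rabs C / e).
  { apply Rmult_le_pos; [apply Rabs_pos|left; apply Rinv_0_lt_compat, he]. }
  assert (hn : Rmax r (Rabs C / e + 1) < norm x) by (destruct Hr; lra).
  assert (Hd : Rabs (w1 x - w2 x) <= C / norm x) by (apply Hdec; auto; lra).
  assert (hle : C / norm x <= e).
  { apply Rmult_le_reg_r with (norm x); [lra|].
    replace (C / norm x * norm x) with C by (field; lra).
    apply Rle_trans with (e * (Rabs C / e)).
    - replace (e * (Rabs C / e)) with (Rabs C) by (field; lra); apply Rle_abs.
    - apply Rmult_le_compat_l; lra. }
  assert (H := Rle_abs (w1 x - w2 x)); lra.
Qed.

Lemma transmission_unique (D Omega : plane -> Prop) (a b a' b' C r : R)
    (w1 w2 : plane -> R) (g1 g2 : plane -> plane) (J : plane -> plane -> R) :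
  0 < a' < a -> 0 < b' < b ->
  (forall x, D x <-> quad a b x < 0) -> (forall x, Omega x <-> quad a' b' x < 0) ->
  transmission D Omega a b a' b' w1 g1 J -> transmission D Omega a b a' b' w2 g2 J ->
  (forall x, 0 < quad a b x -> quad a' b' x <> 0 -> 0 < norm x -> r <= norm x ->
     Rabs (w1 x - w2 x) <= C / norm x) ->
  forall x, 0 < quad a b x -> quad a' b' x <> 0 -> w1 x = w2 x.
Proof.
intros ha hb hD hO T1 T2 Hdec x H1 H2; apply Rle_antisym.
- apply (transmission_comparison D Omega a b a' b' C r w1 w2 g1 g2 J); auto.
- apply (transmission_comparison D Omega a b a' b' C r w2 w1 g2 g1 J); auto.
  intros y; rewrite Rabs_minus_sym; apply Hdec.
Qed.

(** One coordinate exceeds [/ a + 1] or [/ b + 1] in absolute value. Being larger than 1, it is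
    smaller than its square, so no square root is needed in the bound. *)
Lemma quad_pos_far (a b : R) (x : plane) :
  0 < a -> 0 < b -> / a + / b + 2 < norm x -> 0 < quad a b x.
Proof.
intros ha hb Hx.
assert (ia := Rinv_0_lt_compat a ha); assert (ib := Rinv_0_lt_compat b hb).
assert (hn : norm x <= Rabs (fst x) + Rabs (snd x)).
{ rewrite norm_Cmod; replace (x : C) with (RtoC (fst x) + RtoC (snd x) * Ci)%C
    by (apply injective_projections; simpl; ring).
  eapply Rle_trans; [apply Cmod_triangle|].
  rewrite Cmod_mult, Cmod_Ci, !Cmod_R, Rmult_1_r; simpl.
  apply Req_le; f_equal; f_equal; ring. }
assert (Hsq : forall c y, 0 < c -> / c + 1 < Rabs y -> 1 < c * y ^ 2).
{ intros c y hc hy; rewrite <- pow2_abs.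
  assert (ic := Rinv_0_lt_compat c hc).
  assert (/ c < Rabs y ^ 2) by (simpl; nra).
  replace 1 with (c * / c) by (field; lra); apply Rmult_lt_compat_l; assumption. }
assert (0 <= a * fst x ^ 2) by (apply Rmult_le_pos; [lra|apply pow2_ge_0]).
assert (0 <= b * snd x ^ 2) by (apply Rmult_le_pos; [lra|apply pow2_ge_0]).
unfold quad; destruct (Rlt_or_le (/ a + 1) (Rabs (fst x))) as [h|h].
- assert (h' := Hsq a (fst x) ha h); lra.
- assert (h' : / b + 1 < Rabs (snd x)) by lra; assert (h'' := Hsq b (snd x) hb h'); lra.
Qed.

(** Harmonicity across the outer ellipse is transmission with zero jump, so a single uniqueness
    result serves both the potential and the pressure. *)
Lemma smooth_transmission (D Omega : plane -> Prop) (a b a' b' : R)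
    (w : plane -> R) (g : plane -> plane) :
  0 < a' < a -> 0 < b' < b ->
  (forall x, 0 < quad a b x -> laplacian_at w g 0 x) ->
  (forall x nu k, quad a b x = 0 -> 0 < k -> quad_grad a b x = scal k nu ->
     outward_unit_normal D x nu ->
     exists v, is_trace (fun y => 0 < quad a b y) w x v /\
     filterlim (fun t => dot (g (plus x (scal t nu))) nu) (at_right 0) (locally 0)) ->
  transmission D Omega a b a' b' w g (fun _ _ => 0).
Proof.
intros ha hb HL HI; split; [auto|split; [exact HI|]].
intros x nu k hx hk Hk _.
assert (HLx : laplacian_at w g 0 x) by (apply HL, quad_nested with a' b'; lra).
assert (Hc : continuous w x) by apply HLx.
exists (w x), (dot (g x) nu), (dot (g x) nu).
split; [|split; [|split; [|split]]].
- apply is_trace_continuous, Hc.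
- apply is_trace_continuous, Hc.
- exact (laplacian_at_ray_flux _ _ _ x nu nu HLx).
- exact (laplacian_at_ray_flux _ _ _ x nu (opp nu) HLx).
- ring.
Qed.

Lemma grad_minus_ray (f : plane -> R) (x nu : plane) (v : R) :
  is_normal_derivative_minus f x nu v ->
  filterlim (fun t => dot (grad f (plus x (scal t (opp nu)))) nu) (at_right 0) (locally v).
Proof.
apply filterlim_ext; intros t; do 2 f_equal.
apply injective_projections; unfold minus, plus, scal, opp; simpl;
unfold minus, plus, scal, opp; simpl; unfold mult; simpl; ring.
Qed.

Lemma is_derive_pair (u v : R -> R) (t du dv : R) :
  is_derive u t du -> is_derive v t dv -> is_derive (fun s => (u s, v s) : plane) t (du, dv).
Proof.
intros Hu Hv.
assert (E1 : forall s r : R, plus (scal s ((1, 0) : plane)) (scal r ((0, 1) : plane)) = (s, r)).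
{ intros s r; apply injective_projections; unfold plus, scal; simpl;
  unfold plus, scal; simpl; unfold mult; simpl; ring. }
rewrite <- (E1 du dv).
apply is_derive_ext with
  (fun s => plus (scal (u s) ((1, 0) : plane)) (scal (v s) ((0, 1) : plane))).
- intros s; apply E1.
- apply (is_derive_plus (K := R_AbsRing)
    (V := prod_NormedModule R_AbsRing R_NormedModule R_NormedModule)).
  + apply (is_derive_scal_l (K := R_AbsRing)
      (V := prod_NormedModule R_AbsRing R_NormedModule R_NormedModule)); exact Hu.
  + apply (is_derive_scal_l (K := R_AbsRing)
      (V := prod_NormedModule R_AbsRing R_NormedModule R_NormedModule)); exact Hv.
Qed.

Lemma cos_sin_injective (s t : R) :
  0 <= s < 2 * PI -> 0 <= t < 2 * PI -> cos s = cos t -> sin s = sin t -> s = t.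
Proof.
assert (Haux : forall u, 0 < u < 2 * PI -> cos u <> 1).
{ intros u hu hc.
  assert (h : 0 < sin (u / 2)) by (apply sin_gt_0; lra).
  replace u with (2 * (u / 2)) in hc by field; rewrite cos_2a_sin in hc.
  assert (0 < sin (u / 2) * sin (u / 2)) by (apply Rmult_lt_0_compat; exact h); lra. }
intros hs ht hc hsn.
assert (h1 : cos (s - t) = 1).
{ rewrite cos_minus, hc, hsn; assert (H' := sin2_cos2 t); unfold Rsqr in H'; lra. }
destruct (Rtotal_order s t) as [h|[h|h]]; [exfalso|exact h|exfalso].
- apply (Haux (t - s)); [lra|]; rewrite <- h1, <- (cos_neg (s - t)); f_equal; ring.
- apply (Haux (s - t)); [lra|exact h1].
Qed.

(** * The solution for a single angular mode *)

Section Solution.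

(** [sigma] is the relative coefficient of the decaying exponential in the data, [sigma'] that of
    the pressure outside [Omega], and [c] the amplitude of the pressure between the ellipses.
    Keeping [sigma'] and [c] general lets cloaking ([sigma' = sigma]) and shielding ([c = 0]) share
    one solution. *)
Variables (l xi_i xi_e : R) (n : nat) (kappa : C) (sigma sigma' c zeta0 : R).
Variables (D Omega : plane -> Prop) (H P phi p : plane -> R).
Hypotheses (hl : 0 < l) (hi : 0 < xi_i) (hie : xi_i < xi_e) (hn : (1 <= n)%nat).
Hypotheses (hD : D = elliptic_domain l xi_i) (hOmega : Omega = elliptic_domain l xi_e).
Hypothesis hsol : electro_osmotic D Omega zeta0 H P phi p.
Hypothesis hH : forall x, off_segment l x -> H x = mode l n kappa (1 / 2) (sigma / 2) x.
Hypothesis hP : forall x, off_segment l x -> P x = mode l n kappa 6 (6 * sigma) x.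

Let E := exp (INR n * xi_e).
Let F := exp (- (INR n * xi_e)).
Let G := exp (2 * (INR n * xi_i)).

(** Continuity of the pressure and the jump of its flux across the outer ellipse. *)
Hypothesis h_trace : E + sigma' * F = c * (E + G * F).
Hypothesis h_jump : (E - sigma' * F) - c * (E - G * F) = zeta0 * (E - G * F).

Let a := ell_a l xi_i.
Let b := ell_b l xi_i.
Let a' := ell_a l xi_e.
Let b' := ell_b l xi_e.

Lemma ell_a_nested : 0 < a' < a.
Proof. split; [apply ell_a_pos, hl|apply ell_a_lt; auto]. Qed.

Lemma ell_b_nested : 0 < b' < b.
Proof. split; [apply ell_b_pos; lra|apply ell_b_lt; auto]. Qed.

Lemma inner_quad (x : plane) : D x <-> quad a b x < 0.
Proof. rewrite hD; apply elliptic_domain_quad; assumption. Qed.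

Lemma outer_quad (x : plane) : Omega x <-> quad a' b' x < 0.
Proof. rewrite hOmega; apply elliptic_domain_quad; lra. Qed.

Lemma exterior_inner (x : plane) : exterior D x <-> 0 < quad a b x.
Proof.
assert (ha := ell_a_nested); assert (hb := ell_b_nested).
apply exterior_quad; [lra|lra|exact inner_quad].
Qed.

Lemma boundary_inner (x : plane) : boundary D x <-> quad a b x = 0.
Proof.
assert (ha := ell_a_nested); assert (hb := ell_b_nested).
apply boundary_quad; [lra|lra|exact inner_quad].
Qed.

Lemma exterior_outer (x : plane) : exterior Omega x <-> 0 < quad a' b' x.
Proof.
assert (ha := ell_a_nested); assert (hb := ell_b_nested).
apply exterior_quad; [lra|lra|exact outer_quad].
Qed.

Lemma boundary_outer (x : plane) : boundary Omega x <-> quad a' b' x = 0.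
Proof.
assert (ha := ell_a_nested); assert (hb := ell_b_nested).
apply boundary_quad; [lra|lra|exact outer_quad].
Qed.

Lemma off_segment_inner (x : plane) : 0 <= quad a b x -> off_segment l x.
Proof. apply off_segment_quad; assumption. Qed.

(** On the inner ellipse [exp (2 n xi_i) exp (- n xi) = exp (n xi)], so these modes have no
    flux through it. *)
Lemma mode_inner_condition (alpha : R) (x nu : plane) (k : R) :
  quad a b x = 0 -> 0 < k -> quad_grad a b x = scal k nu ->
  exists v, is_trace (fun y => 0 < quad a b y) (mode l n kappa alpha (alpha * G)) x v /\
  filterlim (fun t => dot (mode_grad l n kappa alpha (alpha * G) (plus x (scal t nu))) nu)
    (at_right 0) (locally 0).
Proof.
intros hx hk Hk.
assert (Hoff : off_segment l x) by (apply off_segment_inner; lra).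
assert (HL := mode_laplacian_at l n kappa alpha (alpha * G) x hl Hoff).
exists (mode l n kappa alpha (alpha * G) x); split.
- apply is_trace_continuous, HL.
- destruct (mode_normal_derivative l n kappa xi_i k x nu) as [m Hm]; auto.
  assert (Hf := laplacian_at_ray_flux _ _ _ x nu nu HL).
  replace (dot (mode_grad l n kappa alpha (alpha * G) x) nu) with 0 in Hf; [exact Hf|].
  rewrite Hm; unfold G; rewrite Rmult_assoc, <- exp_plus.
  replace (2 * (INR n * xi_i) + - (INR n * xi_i)) with (INR n * xi_i) by ring; ring.
Qed.

Let phi0 := mode l n kappa (1 / 2) (1 / 2 * G).
Let dphi0 := mode_grad l n kappa (1 / 2) (1 / 2 * G).

Lemma phi_harmonic_at (x : plane) : 0 < quad a b x -> laplacian_at phi (grad phi) 0 x.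
Proof.
intros hx; apply (harmonic_laplacian_at (exterior D)).
- generalize (quad_pos_near _ _ _ hx); apply filter_imp; intros z; apply exterior_inner.
- apply (phi_harmonic _ _ _ _ _ _ _ hsol).
Qed.

Lemma phi_off_interface (x : plane) : 0 < quad a b x -> quad a' b' x <> 0 -> phi x = phi0 x.
Proof.
assert (ha := ell_a_nested); assert (hb := ell_b_nested).
destruct (phi_infinity _ _ _ _ _ _ _ hsol) as [C [r [hr Hr]]].
(* The constant adds the error of [phi] against [H] to the difference between the decaying parts of
   [H] and [phi0]. *)
apply (transmission_unique D Omega a b a' b'
  (C + Cmod kappa * Rabs (sigma / 2 - 1 / 2 * G) * l) r
  phi phi0 (grad phi) dphi0 (fun _ _ => 0)); auto.
- exact inner_quad.
- exact outer_quad.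
- apply smooth_transmission; auto.
  + exact phi_harmonic_at.
  + intros y nu k hy hk Hk Hn.
    destruct (phi_trace_D _ _ _ _ _ _ _ hsol y) as [v Hv]; [apply boundary_inner, hy|].
    exists v; split; [|apply (phi_neumann_D _ _ _ _ _ _ _ hsol), Hn].
    apply is_trace_subset with (2 := Hv); intros z; apply exterior_inner.
- apply smooth_transmission; auto.
  + intros y hy; apply mode_laplacian_at; [exact hl|apply off_segment_inner; lra].
  + intros y nu k hy hk Hk _; apply mode_inner_condition with k; assumption.
- intros y h1 h2 h3 h4.
  assert (Hoff : off_segment l y) by (apply off_segment_inner; lra).
  assert (H1 := Hr y h4); rewrite (hH y Hoff) in H1.
  assert (H2 := mode_difference_decay l n kappa (1 / 2) (sigma / 2) (1 / 2 * G) y hl hn Hoff h3).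
  replace (phi y - phi0 y) with ((phi y - mode l n kappa (1 / 2) (sigma / 2) y)
    + (mode l n kappa (1 / 2) (sigma / 2) y - phi0 y)) by ring.
  eapply Rle_trans; [apply Rabs_triang|].
  rewrite Rdiv_plus_distr; apply Rplus_le_compat; assumption.
Qed.

(** The pressure jump evaluates the gradient of [phi] on the outer ellipse itself, which uniqueness
    leaves out. Both functions are continuous there, so the equality passes to the limit along the
    outward normal. *)
Lemma phi_explicit (x : plane) : 0 < quad a b x -> phi x = phi0 x.
Proof.
assert (ha := ell_a_nested); assert (hb := ell_b_nested).
intros hx; destruct (Req_dec (quad a' b' x) 0) as [hx'|hx'];
  [|apply phi_off_interface; assumption].
destruct (quad_outward_normal a' b' Omega) with (x := x) as [k [nu [hk [Hk Hn]]]];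
  auto; try lra; [exact outer_quad|].
destruct (quad_outward_ray a' b' k x nu) as [_ [Hpos _]]; auto; try lra.
assert (C1 : continuous phi x) by apply (phi_harmonic_at x hx).
assert (C2 : continuous phi0 x).
{ apply (mode_laplacian_at l n kappa (1 / 2) (1 / 2 * G) x hl), off_segment_inner; lra. }
assert (L1 := filterlim_comp _ _ _ _ phi _ _ _ (ray_to_point x nu) C1).
assert (L2 := filterlim_comp _ _ _ _ phi0 _ _ _ (ray_to_point x nu) C2).
apply (filterlim_locally_unique (V := R_NormedModule) _ _ _ L1).
eapply filterlim_ext_loc; [|exact L2].
apply (eventually_at_right _ 1 Rlt_0_1); intros t [ht _].
specialize (Hpos t ht); symmetry; apply phi_off_interface; [|lra].
apply quad_nested with a' b'; auto; lra.
Qed.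

Lemma phi_grad_explicit (x : plane) : 0 < quad a b x -> grad phi x = dphi0 x.
Proof.
intros hx; apply (laplacian_at_grad_unique phi phi0 (grad phi) dphi0 0 0).
- apply phi_harmonic_at, hx.
- apply mode_laplacian_at; [exact hl|apply off_segment_inner; lra].
- generalize (quad_pos_near _ _ _ hx); apply filter_imp; exact phi_explicit.
Qed.

(** Zero flux through the inner ellipse leaves only the amplitude [c], so this is [12 * c] times
    [phi0]. Outside, the coefficient 6 is dictated by [P]. *)
Let p_in := mode l n kappa (6 * c) (6 * c * G).
Let dp_in := mode_grad l n kappa (6 * c) (6 * c * G).
Let p_out := mode l n kappa 6 (6 * sigma').
Let dp_out := mode_grad l n kappa 6 (6 * sigma').

(** On the outer ellipse the outer formula is the default; only limits from the two sides enter. *)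
Let p0 (x : plane) : R := if Rlt_dec (quad a' b' x) 0 then p_in x else p_out x.
Let dp0 (x : plane) : plane := if Rlt_dec (quad a' b' x) 0 then dp_in x else dp_out x.

Lemma p0_inside (x : plane) : quad a' b' x < 0 -> p0 x = p_in x /\ dp0 x = dp_in x.
Proof. intros hx; unfold p0, dp0; destruct (Rlt_dec (quad a' b' x) 0); [auto|lra]. Qed.

Lemma p0_outside (x : plane) : 0 < quad a' b' x -> p0 x = p_out x /\ dp0 x = dp_out x.
Proof. intros hx; unfold p0, dp0; destruct (Rlt_dec (quad a' b' x) 0); [lra|auto]. Qed.

Lemma p0_transmission :
  transmission D Omega a b a' b' p0 dp0 (fun x nu => 12 * zeta0 * dot (grad phi x) nu).
Proof.
assert (ha := ell_a_nested); assert (hb := ell_b_nested).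
assert (Lin : forall x, 0 <= quad a b x -> laplacian_at p_in dp_in 0 x).
{ intros x hx; apply mode_laplacian_at; [exact hl|apply off_segment_inner, hx]. }
assert (Lout : forall x, 0 <= quad a b x -> laplacian_at p_out dp_out 0 x).
{ intros x hx; apply mode_laplacian_at; [exact hl|apply off_segment_inner, hx]. }
split; [|split].
- intros x hx hx'; destruct (Rlt_or_le (quad a' b' x) 0) as [h|h].
  + apply laplacian_at_ext with p_in dp_in; [|apply Lin; lra].
    generalize (quad_neg_near _ _ _ h); apply filter_imp; intros y hy.
    destruct (p0_inside y hy) as [-> ->]; auto.
  + assert (h' : 0 < quad a' b' x) by lra.
    apply laplacian_at_ext with p_out dp_out; [|apply Lout; lra].
    generalize (quad_pos_near _ _ _ h'); apply filter_imp; intros y hy.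
    destruct (p0_outside y hy) as [-> ->]; auto.
- intros x nu k hx hk Hk _.
  destruct (mode_inner_condition (6 * c) x nu k) as [v [Tv Fv]]; auto.
  assert (h : quad a' b' x < 0).
  { apply Rnot_le_lt; intros h; assert (H' := quad_nested a b a' b' x ha hb h); lra. }
  exists v; split.
  + intros Q HQ; specialize (Tv Q HQ).
    unfold filtermap, within in *.
    generalize (filter_and _ _ Tv (quad_neg_near _ _ _ h)); apply filter_imp.
    intros y [H1 H2] H3; rewrite (proj1 (p0_inside y H2)); apply H1, H3.
  + eapply filterlim_ext_loc; [|exact Fv].
    generalize (ray_eventually x nu _ (quad_neg_near _ _ _ h)); apply filter_imp.
    intros t Ht; exact (f_equal (fun u => dot u nu) (eq_sym (proj2 (p0_inside _ Ht)))).
- intros x nu k hx hk Hk _.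
  assert (hx' : 0 < quad a b x) by (apply quad_nested with a' b'; auto; lra).
  destruct (quad_outward_ray a' b' k x nu) as [_ [Hpos Hneg]]; auto; try lra.
  exists (p_out x), (dot (dp_out x) nu), (dot (dp_in x) nu).
  split; [|split; [|split; [|split]]].
  + eapply filterlim_within_ext; [|apply is_trace_continuous, Lout; lra].
    intros y hy; symmetry; apply p0_outside, hy.
  + assert (Eio : p_out x = p_in x).
    { destruct (elliptic_surjective l x hl) as [xi [eta [h1 [_ Hx]]]].
      assert (hxi : xi = xi_e) by (rewrite Hx in hx; apply quad_elliptic_sign in hx; auto; lra).
      subst xi; rewrite Hx; unfold p_out, p_in; rewrite !mode_elliptic by lra; fold E F.
      replace (6 * E + 6 * sigma' * F) with (6 * (E + sigma' * F)) by ring.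
      rewrite h_trace; ring. }
    rewrite Eio; eapply filterlim_within_ext; [|apply is_trace_continuous, Lin; lra].
    intros y [hy _]; symmetry; apply p0_inside, hy.
  + assert (Hf := laplacian_at_ray_flux _ _ _ x nu nu (Lout x (Rlt_le _ _ hx'))).
    eapply filterlim_ext_loc; [|exact Hf].
    apply (eventually_at_right _ 1 Rlt_0_1); intros t [ht _].
    exact (f_equal (fun u => dot u nu) (eq_sym (proj2 (p0_outside _ (Hpos t ht))))).
  + assert (Hf := laplacian_at_ray_flux _ _ _ x nu (opp nu) (Lin x (Rlt_le _ _ hx'))).
    eapply filterlim_ext_loc; [|exact Hf].
    generalize Hneg; apply filter_imp; intros t Ht.
    exact (f_equal (fun u => dot u nu) (eq_sym (proj2 (p0_inside _ Ht)))).
  + rewrite (phi_grad_explicit x hx').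
    destruct (mode_normal_derivative l n kappa xi_e k x nu) as [m Hm]; auto; try lra.
    unfold dp_out, dp_in, dphi0; rewrite !Hm; fold E F.
    (* The same [m] occurs in all three normal derivatives and factors out; the coefficient 1/2 of
       [phi0] turns the 12 of the jump into 6. *)
    transitivity (6 * m * ((E - sigma' * F) - c * (E - G * F))); [ring|].
    rewrite h_jump; field.
Qed.

Lemma p_explicit (x : plane) : 0 < quad a b x -> quad a' b' x <> 0 -> p x = p0 x.
Proof.
assert (ha := ell_a_nested); assert (hb := ell_b_nested).
destruct (p_infinity _ _ _ _ _ _ _ hsol) as [C [r [hr Hr]]].
(* The second radius lies beyond the outer ellipse, where [p0] is [p_out]; 3 in place of the 2 in
   [quad_pos_far] makes the inequality strict. *)
apply (transmission_unique D Omega a b a' b'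
  (C + Cmod kappa * Rabs (6 * sigma - 6 * sigma') * l) (Rmax r (/ a' + / b' + 3))
  p p0 (grad p) dp0 (fun x nu => 12 * zeta0 * dot (grad phi x) nu)); auto.
- exact inner_quad.
- exact outer_quad.
- split; [|split].
  + intros y hy hy'.
    apply (harmonic_laplacian_at (fun z => exterior D z /\ ~ boundary Omega z)).
    * assert (Hy' : locally y (fun z => quad a' b' z <> 0)).
      { destruct (Rlt_or_le (quad a' b' y) 0) as [h|h].
        - generalize (quad_neg_near _ _ _ h); apply filter_imp; intros z hz; lra.
        - assert (h' : 0 < quad a' b' y) by lra.
          generalize (quad_pos_near _ _ _ h'); apply filter_imp; intros z hz; lra. }
      generalize (filter_and _ _ (quad_pos_near _ _ _ hy) Hy'); apply filter_imp.
      intros z [H1 H2]; split; [apply exterior_inner, H1|].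
      intros H3; apply H2, boundary_outer, H3.
    * apply (p_harmonic _ _ _ _ _ _ _ hsol).
  + intros y nu k hy hk Hk Hn.
    destruct (p_trace_D _ _ _ _ _ _ _ hsol y) as [v Hv]; [apply boundary_inner, hy|].
    exists v; split; [|apply (p_neumann_D _ _ _ _ _ _ _ hsol), Hn].
    apply is_trace_subset with (2 := Hv); intros z; apply exterior_inner.
  + intros y nu k hy hk Hk Hn.
    destruct (p_trace_Omega _ _ _ _ _ _ _ hsol y) as [v [Hv Hv']]; [apply boundary_outer, hy|].
    destruct (p_jump_Omega _ _ _ _ _ _ _ hsol y nu Hn) as [vp [vm [Hp [Hm Hj]]]].
    exists v, vp, vm; split; [|split; [|split; [|split]]].
    * apply is_trace_subset with (2 := Hv); intros z; apply exterior_outer.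
    * apply is_trace_subset with (2 := Hv'); intros z [H1 H2]; split;
      [apply outer_quad, H1|apply exterior_inner, H2].
    * exact Hp.
    * apply grad_minus_ray, Hm.
    * exact Hj.
- exact p0_transmission.
- intros y h1 h2 h3 h4.
  assert (Hoff : off_segment l y) by (apply off_segment_inner; lra).
  assert (A1 := Rmax_l r (/ a' + / b' + 3)); assert (A2 := Rmax_r r (/ a' + / b' + 3)).
  assert (hy : 0 < quad a' b' y) by (apply quad_pos_far; lra).
  assert (h5 : r <= norm y) by lra.
  assert (H1 := Hr y h5); rewrite (hP y Hoff) in H1.
  assert (H2 := mode_difference_decay l n kappa 6 (6 * sigma) (6 * sigma') y hl hn Hoff h3).
  rewrite (proj1 (p0_outside y hy)).
  replace (p y - p_out y) with ((p y - mode l n kappa 6 (6 * sigma) y)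
    + (mode l n kappa 6 (6 * sigma) y - p_out y)) by ring.
  eapply Rle_trans; [apply Rabs_triang|].
  rewrite Rdiv_plus_distr; apply Rplus_le_compat; assumption.
Qed.

(** The outer pressure is then [P] on an open set, so the gradients agree, and [zeta_mean] vanishes
    there. *)
Lemma cloaking_of_modes : sigma' = sigma -> perfect_cloaking D Omega zeta0 P phi p.
Proof.
assert (ha := ell_a_nested); assert (hb := ell_b_nested).
intros hs x Hx; apply exterior_outer in Hx.
assert (Hp : locally x (fun y => p y = P y)).
{ generalize (quad_pos_near _ _ _ Hx); apply filter_imp; intros y hy.
  assert (hy' : 0 < quad a b y) by (apply quad_nested with a' b'; auto; lra).
  rewrite p_explicit by lra; rewrite (proj1 (p0_outside y hy)).
  rewrite hP by (apply off_segment_inner; lra); unfold p_out; rewrite hs; reflexivity. }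
assert (Hg : grad p x = grad P x).
{ assert (Hp' : locally_2d (fun u v => curried p u v = curried P u v) (fst x) (snd x)).
  { apply locally_2d_locally; destruct x; generalize Hp; apply filter_imp.
    intros [y1 y2] Hy; exact Hy. }
  apply injective_projections; apply partial_derive_ext_loc; exact Hp'. }
unfold u_aver, zeta_mean; rewrite Hg.
destruct (ClassicalEpsilon.excluded_middle_informative _) as [[H1 _]|_].
- apply outer_quad in H1; lra.
- apply injective_projections; unfold minus, plus, scal, opp; simpl;
  unfold minus, plus, scal, opp; simpl; unfold mult; simpl; ring.
Qed.

Lemma ellipse_parametrization :
  boundary_parametrization D 0 (2 * PI) (elliptic l xi_i)
    (fun t => (- (l * cosh xi_i * sin t), l * sinh xi_i * cos t)).
Proof.
assert (hpi := PI_RGT_0).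
assert (hc := cosh_pos xi_i); assert (hs := sinh_pos xi_i hi).
assert (hlc : 0 < l * cosh xi_i) by (apply Rmult_lt_0_compat; assumption).
assert (hls : 0 < l * sinh xi_i) by (apply Rmult_lt_0_compat; assumption).
split; [lra|split; [|split; [|split]]].
- unfold elliptic; rewrite cos_0, sin_0, cos_2PI, sin_2PI; reflexivity.
- intros s t h1 h2 Hst; apply cos_sin_injective; auto.
  + apply Rmult_eq_reg_l with (l * cosh xi_i); [exact (f_equal fst Hst)|lra].
  + apply Rmult_eq_reg_l with (l * sinh xi_i); [exact (f_equal snd Hst)|lra].
- intros x; rewrite boundary_inner; split.
  + destruct (elliptic_surjective l x hl) as [xi [eta [h1 [h2 ->]]]]; intros hx.
    apply quad_elliptic_sign in hx; auto; subst xi; exists eta; auto.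
  + intros [t [_ <-]]; apply quad_elliptic_sign; auto; lra.
- intros t _; split; [|split].
  + apply (is_derive_pair (fun t => l * cosh xi_i * cos t) (fun t => l * sinh xi_i * sin t));
    auto_derive; auto; ring.
  + apply (ex_derive_continuous (K := R_AbsRing)
      (V := prod_NormedModule R_AbsRing R_NormedModule R_NormedModule)).
    eexists; apply is_derive_pair; auto_derive; auto; reflexivity.
  + intros H0.
    assert (H1 : - (l * cosh xi_i * sin t) = 0) by exact (f_equal fst H0).
    assert (H2 : l * sinh xi_i * cos t = 0) by exact (f_equal snd H0).
    assert (S0 : sin t = 0) by (apply Rmult_eq_reg_l with (l * cosh xi_i); lra).
    assert (C0 : cos t = 0) by (apply Rmult_eq_reg_l with (l * sinh xi_i); lra).
    assert (H' := cos2_sin2 t); rewrite S0, C0 in H'; lra.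
Qed.

Lemma shielding_of_modes : c = 0 -> perfect_shielding D p.
Proof.
assert (ha := ell_a_nested); assert (hb := ell_b_nested).
intros hc.
assert (Hb : forall t, quad a b (elliptic l xi_i t) = 0).
{ intros t; apply quad_elliptic_sign; auto; lra. }
assert (Hnu : forall t, exists nu, outward_unit_normal D (elliptic l xi_i t) nu).
{ intros t; destruct (quad_outward_normal a b D) with (x := elliptic l xi_i t)
    as [k [nu [_ [_ Hn]]]]; auto; try lra; [exact inner_quad|exists nu; exact Hn]. }
(* The trace of the pressure will be 0, so an unspecified choice of outward normals is enough. *)
destruct (choice _ Hnu) as [nu Hn].
exists 0, (2 * PI), (elliptic l xi_i),
  (fun t => (- (l * cosh xi_i * sin t), l * sinh xi_i * cos t)), nu, (fun _ => 0).
split; [exact ellipse_parametrization|split; [intros t _; apply Hn|split]].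
- intros t _; set (x := elliptic l xi_i t).
  assert (hx : quad a' b' x < 0).
  { apply Rnot_le_lt; intros h; assert (H' := quad_nested a b a' b' x ha hb h).
    unfold x in H'; rewrite Hb in H'; lra. }
  intros Q HQ; unfold filtermap, within.
  generalize (quad_neg_near _ _ _ hx); apply filter_imp; intros y hy hy'.
  apply exterior_inner in hy'.
  rewrite p_explicit by lra; rewrite (proj1 (p0_inside y hy)).
  replace (p_in y) with 0; [apply locally_singleton, HQ|].
  unfold p_in, mode, cmode; rewrite hc.
  replace (6 * 0 * G) with 0 by ring; replace (6 * 0) with 0 by ring.
  replace (kappa * 0 * / jinv l y ^ n + Cconj kappa * 0 * jinv l y ^ n)%C with (RtoC 0) by ring.
  reflexivity.
- apply is_RInt_ext with (fun _ => ((0, 0) : plane)).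
  + intros t _; apply injective_projections; unfold stress, scal; simpl;
    unfold scal; simpl; unfold mult; simpl; ring.
  + assert (Ez : scal (2 * PI - 0) ((0, 0) : plane) = zero).
    { apply injective_projections; unfold scal; simpl; unfold scal; simpl;
      unfold mult; apply Rmult_0_r. }
    exact (eq_ind _ (fun v : plane => is_RInt (fun _ => ((0, 0) : plane)) 0 (2 * PI) v)
      (is_RInt_const (V := prod_NormedModule R_AbsRing R_NormedModule R_NormedModule)
         0 (2 * PI) (0, 0)) _ Ez).
Qed.

End Solution.

(** * The coefficients *)

(** [off_segment] gives an arbitrary angle, whereas [elliptic_expression] requires one in
    [[0, 2 * PI]]. The new [xi] stays positive because [x] lies outside the ellipse of parameter
    [xi1 / 2]. *)
Lemma off_segment_coordinates (l : R) (x : plane) :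
  0 < l -> off_segment l x ->
  exists xi eta, 0 < xi /\ 0 <= eta <= 2 * PI /\ x = elliptic l xi eta.
Proof.
intros hl [xi1 [eta1 [h1 Hx]]].
destruct (elliptic_surjective l x hl) as [xi [eta [h2 [h3 Hx']]]].
exists xi, eta; split; [|auto].
assert (H : 0 < quad (ell_a l (xi1 / 2)) (ell_b l (xi1 / 2)) x)
  by (rewrite Hx; apply quad_elliptic_sign; lra).
rewrite Hx' in H; apply quad_elliptic_sign in H; lra.
Qed.

Lemma elliptic_expression_mode (l : R) (n : nat) (kappa : C) (alpha beta : R)
    (f : plane -> R) (h : R -> R -> R) :
  0 < l -> elliptic_expression l f h ->
  (forall xi eta, h xi eta = (alpha * exp (INR n * xi) + beta * exp (- (INR n * xi))) *
     (Re kappa * cos (INR n * eta) - Im kappa * sin (INR n * eta))) ->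
  forall x, off_segment l x -> f x = mode l n kappa alpha beta x.
Proof.
intros hl Hf Hh x Hx.
destruct (off_segment_coordinates l x hl Hx) as [xi [eta [h1 [h2 ->]]]].
rewrite Hf by lra; rewrite mode_elliptic by assumption; apply Hh.
Qed.

Section Coefficients.

Variables (n : nat) (xi_i xi_e sigma : R).
Hypotheses (hie : xi_i < xi_e) (hn : (1 <= n)%nat).

Let A := exp (INR n * xi_i).
Let E := exp (INR n * xi_e).
(** This is sinh for [sigma = 1] and cosh for [sigma = -1]. *)
Let s_i := (A - sigma * exp (- (INR n * xi_i))) / 2.
Let s_e := (E - sigma * exp (- (INR n * xi_e))) / 2.
Let den := s_e - exp (INR n * (xi_i - xi_e)) * s_i.

Lemma exp_inner_lt_outer : 0 < A < E.
Proof.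
split; [apply exp_pos|apply exp_increasing, Rmult_lt_compat_l; [|exact hie]].
apply lt_0_INR; lia.
Qed.

(** The terms with [sigma] cancel, so the denominators of both parts of the theorem are the same
    number, positive by [squares_lt]. *)
Lemma den_eq : den = (E * E - A * A) / (2 * E).
Proof.
assert (h := exp_inner_lt_outer).
unfold den, s_e, s_i.
replace (INR n * (xi_i - xi_e)) with (INR n * xi_i + - (INR n * xi_e)) by ring.
rewrite exp_plus, !exp_Ropp; fold A E; field; lra.
Qed.

Lemma squares_lt : 0 < E * E - A * A.
Proof. assert (h := exp_inner_lt_outer); nra. Qed.

Lemma exp_double : exp (2 * (INR n * xi_i)) = A * A.
Proof. unfold A; rewrite <- exp_plus; f_equal; ring. Qed.

Lemma cloaking_coefficients (zeta0 : R) :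
  zeta0 = s_i / (den * cosh (INR n * (xi_e - xi_i))) ->
  exists c, E + sigma * exp (- (INR n * xi_e)) =
    c * (E + exp (2 * (INR n * xi_i)) * exp (- (INR n * xi_e))) /\
  (E - sigma * exp (- (INR n * xi_e))) -
    c * (E - exp (2 * (INR n * xi_i)) * exp (- (INR n * xi_e))) =
  zeta0 * (E - exp (2 * (INR n * xi_i)) * exp (- (INR n * xi_e))).
Proof.
assert (h := exp_inner_lt_outer); assert (h' := squares_lt).
assert (hp : 0 < E * E + A * A) by nra.
rewrite den_eq, exp_double; unfold s_i, cosh.
replace (INR n * (xi_e - xi_i)) with (INR n * xi_e + - (INR n * xi_i)) by ring.
replace (- (INR n * xi_e + - (INR n * xi_i))) with (INR n * xi_i + - (INR n * xi_e)) by ring.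
rewrite !exp_plus, !exp_Ropp; fold A E; intros ->.
(* The first equation, continuity, determines [c]; the second is then satisfied by the given
   [zeta0]. *)
exists ((E * E + sigma) / (E * E + A * A)); split; field; repeat split; lra.
Qed.

(** With [c = 0], continuity forces [sigma' = - E ^ 2]. The outer flux coefficient is then [2 * E],
    and dividing it by that of the potential gives [zeta0]. *)
Lemma shielding_coefficients (zeta0 : R) :
  zeta0 = E / den ->
  E + - (E * E) * exp (- (INR n * xi_e)) =
    0 * (E + exp (2 * (INR n * xi_i)) * exp (- (INR n * xi_e))) /\
  (E - - (E * E) * exp (- (INR n * xi_e))) -
    0 * (E - exp (2 * (INR n * xi_i)) * exp (- (INR n * xi_e))) =
  zeta0 * (E - exp (2 * (INR n * xi_i)) * exp (- (INR n * xi_e))).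
Proof.
assert (h := exp_inner_lt_outer); assert (h' := squares_lt).
rewrite den_eq, exp_double, exp_Ropp; fold E; intros ->; split; field; lra.
Qed.

End Coefficients.

Theorem theorem2p2 (l xi_i xi_e : R) (n : nat)
    (hl : 0 < l) (hi : 0 < xi_i) (hie : xi_i < xi_e) (hn : (1 <= n)%nat)
    (D Omega : R * R -> Prop)
    (hD : D = elliptic_domain l xi_i) (hOmega : Omega = elliptic_domain l xi_e)
    (zeta0 : R) (H P phi p : R * R -> R)
    (hsol : electro_osmotic D Omega zeta0 H P phi p) :
  (elliptic_expression l H (fun xi eta => cosh (INR n * xi) * cos (INR n * eta)) ->
   elliptic_expression l P (fun xi eta => 12 * cosh (INR n * xi) * cos (INR n * eta)) ->
   (zeta0 = sinh (INR n * xi_i) /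
      ((sinh (INR n * xi_e) - exp (INR n * (xi_i - xi_e)) * sinh (INR n * xi_i)) *
       cosh (INR n * (xi_e - xi_i))) ->
    perfect_cloaking D Omega zeta0 P phi p) /\
   (zeta0 = exp (INR n * xi_e) /
      (sinh (INR n * xi_e) - exp (INR n * (xi_i - xi_e)) * sinh (INR n * xi_i)) ->
    perfect_shielding D p)) /\
  (elliptic_expression l H (fun xi eta => sinh (INR n * xi) * sin (INR n * eta)) ->
   elliptic_expression l P (fun xi eta => 12 * sinh (INR n * xi) * sin (INR n * eta)) ->
   (zeta0 = cosh (INR n * xi_i) /
      ((cosh (INR n * xi_e) - exp (INR n * (xi_i - xi_e)) * cosh (INR n * xi_i)) *
       cosh (INR n * (xi_e - xi_i))) ->
    perfect_cloaking D Omega zeta0 P phi p) /\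
   (zeta0 = exp (INR n * xi_e) /
      (cosh (INR n * xi_e) - exp (INR n * (xi_i - xi_e)) * cosh (INR n * xi_i)) ->
    perfect_shielding D p)).
Proof.
assert (Hcloak : forall kappa sigma,
  (forall x, off_segment l x -> H x = mode l n kappa (1 / 2) (sigma / 2) x) ->
  (forall x, off_segment l x -> P x = mode l n kappa 6 (6 * sigma) x) ->
  zeta0 = (exp (INR n * xi_i) - sigma * exp (- (INR n * xi_i))) / 2 /
    (((exp (INR n * xi_e) - sigma * exp (- (INR n * xi_e))) / 2 -
      exp (INR n * (xi_i - xi_e)) * ((exp (INR n * xi_i) - sigma * exp (- (INR n * xi_i))) / 2)) *
     cosh (INR n * (xi_e - xi_i))) -> perfect_cloaking D Omega zeta0 P phi p).
{ intros kappa sigma HH HP Hz.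
  destruct (cloaking_coefficients n xi_i xi_e sigma hie hn zeta0 Hz) as [c [H1 H2]].
  apply (cloaking_of_modes l xi_i xi_e n kappa sigma sigma c zeta0 D Omega H P phi p); auto. }
assert (Hshield : forall kappa sigma,
  (forall x, off_segment l x -> H x = mode l n kappa (1 / 2) (sigma / 2) x) ->
  (forall x, off_segment l x -> P x = mode l n kappa 6 (6 * sigma) x) ->
  zeta0 = exp (INR n * xi_e) /
    ((exp (INR n * xi_e) - sigma * exp (- (INR n * xi_e))) / 2 -
      exp (INR n * (xi_i - xi_e)) * ((exp (INR n * xi_i) - sigma * exp (- (INR n * xi_i))) / 2)) ->
  perfect_shielding D p).
{ intros kappa sigma HH HP Hz.
  destruct (shielding_coefficients n xi_i xi_e sigma hie hn zeta0 Hz) as [H1 H2].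
  apply (shielding_of_modes l xi_i xi_e n kappa sigma
    (- (exp (INR n * xi_e) * exp (INR n * xi_e))) 0 zeta0 D Omega H P phi p); auto. }
assert (Esinh : forall x, sinh x = (exp x - 1 * exp (- x)) / 2) by (intros x; unfold sinh; field).
assert (Ecosh : forall x, cosh x = (exp x - -1 * exp (- x)) / 2) by (intros x; unfold cosh; field).
split; intros HH HP.
- assert (HH' : forall x, off_segment l x -> H x = mode l n (RtoC 1) (1 / 2) (1 / 2) x).
  { apply (elliptic_expression_mode _ _ _ _ _ _ _ hl HH).
    intros xi eta; unfold cosh; simpl; field. }
  assert (HP' : forall x, off_segment l x -> P x = mode l n (RtoC 1) 6 (6 * 1) x).
  { apply (elliptic_expression_mode _ _ _ _ _ _ _ hl HP).
    intros xi eta; unfold cosh; simpl; field. }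
  split; intros Hz; rewrite !Esinh in Hz.
  + exact (Hcloak (RtoC 1) 1 HH' HP' Hz).
  + exact (Hshield (RtoC 1) 1 HH' HP' Hz).
(* With [kappa = - Ci] the angular factor [Re kappa cos - Im kappa sin] is the sine, and the sinh
   profile corresponds to [sigma = -1]. *)
- assert (HH' : forall x, off_segment l x -> H x = mode l n (- Ci)%C (1 / 2) (-1 / 2) x).
  { apply (elliptic_expression_mode _ _ _ _ _ _ _ hl HH).
    intros xi eta; unfold sinh; simpl; field. }
  assert (HP' : forall x, off_segment l x -> P x = mode l n (- Ci)%C 6 (6 * -1) x).
  { apply (elliptic_expression_mode _ _ _ _ _ _ _ hl HP).
    intros xi eta; unfold sinh; simpl; field. }
  split; intros Hz.
  (* The rewriting goes backwards because expanding every cosh in [Hz] would also expand the factor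
     [cosh (INR n * (xi_e - xi_i))], which has to stay. *)
  + apply (Hcloak (- Ci)%C (-1) HH' HP'); rewrite <- !Ecosh; exact Hz.
  + apply (Hshield (- Ci)%C (-1) HH' HP'); rewrite <- !Ecosh; exact Hz.
Qed.
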